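(* Let $P$ be a stationary and ergodic probability measure on environments $\Omega=(0,1)^{\mathbb{Z}}$ satisfying conditions (A1)--(A4) listed in the context, let $X=\{X_n\}_{n\ge 0}$ be the random walk in random environment with annealed law $\mathbb{P}$, let $T_n=\min\{i: X_i=n\}$ for $n\in\mathbb{N}$, and let $\kappa=\min_{y>0} J(y)/y$, where $J$ is the rate function in (A2). Let $\alpha>0$. Then, under $\mathbb{P}$, as $n\to\infty$: if $\alpha<\kappa$, then $n^{-1/\alpha}T_n\to 0$ in probability; if $\alpha>\kappa$, then $n^{-1/\alpha}T_n\to\infty$ in probability.
   Context: Environments. $\Omega=(0,1)^{\mathbb{Z}}$ with its Borel $\sigma$-algebra $\mathcal{F}$; $P$ is a stationary and ergodic probability measure on $(\Omega,\mathcal{F})$ with expectation $E_P$; $\omega=\{\omega_i\}_{i\in\mathbb{Z}}\in\Omega$ is the environment, and $\rho_n=(1-\omega_n)/\omega_n$. Random walk. Given $\omega$, the quenched law $P_\omega$ makes $X=\{X_n\}_{n\ge 0}$ a time-homogeneous Markov chain on $\mathbb{Z}$ with $P_\omega(X_0=0)=1$, $P_\omega(X_{n+1}=i+1\mid X_n=i)=\omega_i$ and $P_\omega(X_{n+1}=i-1\mid X_n=i)=1-\omega_i$. The annealed law is $\mathbb{P}(F\times G)=\int_F P_\omega(G)\,P(d\omega)$ for $F\in\mathcal{F}$ and $G$ in the cylinder $\sigma$-algebra on path space. Conditions on the environment. (A1) The series $\sum_{n=1}^\infty n^\xi\,\eta(n)$ converges for every $\xi>0$, where $\eta(n)=\sup\{|P(A\cap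 B)-P(A)P(B)|: A\in\sigma(\omega_i:i\le 0),\ B\in\sigma(\omega_i:i\ge n)\}$. (A2) The sequence $\overline{V}_n=n^{-1}\sum_{i=0}^{n-1}\log\rho_i$ satisfies the Large Deviation Principle with a good rate function $J:\mathbb{R}\to[0,\infty]$: the level sets $J^{-1}([0,a])$ are compact for every $a>0$, and for every Borel set $A\subset\mathbb{R}$, $-\inf_{x\in A^{o}}J(x)\le\liminf_{n\to\infty}\frac1n\log P(\overline{V}_n\in A)\le\limsup_{n\to\infty}\frac1n\log P(\overline{V}_n\in A)\le-\inf_{x\in\mathrm{cl}(A)}J(x)$, where $A^o$ is the interior and $\mathrm{cl}(A)$ the closure of $A$. (A3) $\limsup_{n\to\infty}\frac1n\log E_P\bigl(\prod_{i=0}^{n-1}\rho_i^\lambda\bigr)<\infty$ for all $\lambda\in\mathbb{R}$. (A4) $\limsup_{n\to\infty}\frac1n\log E_P\bigl(\prod_{i=0}^{n-1}\rho_i\bigr)\ge 0$, and $\limsup_{n\to\infty}\frac1n\log E_P\bigl(\prod_{i=0}^{n-1}\rho_i^{\lambda_1}\bigr)<0$ for some $\lambda_1>0$. Convergence of random variables $Y_n$ to $\infty$ in probability means $\mathbb{P}(Y_n>M)\to1$ for every $M\in\mathbb{R}$. *)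

(* Defs.v *)
From HB Require Import structures.
From mathcomp Require Import all_boot all_order all_algebra.
From mathcomp Require Import all_classical all_reals all_analysis.
Import Order.TTheory GRing.Theory Num.Theory numFieldNormedType.Exports.

Set Implicit Arguments.
Unset Strict Implicit.
Unset Printing Implicit Defensive.

Local Open Scope classical_set_scope.
Local Open Scope ring_scope.

Section Environment.
Variable R : realType.

Definition unit_itv : Type := set_type (`]0, 1[%classic : set R).
HB.instance Definition _ := Topological.on unit_itv.

Lemma half_in_unit_itv : 2^-1 \in (`]0, 1[%classic : set R).
Proof.
by rewrite inE /= in_itv /= invr_gt0 ltr0n invf_lt1 ?ltr0n// ltr1n.
Qed.

(* A base point is required of measurable types; which one is irrelevant. *)
HB.instance Definition _ :=
  isPointed.Build unit_itv (exist _ (2^-1 : R) half_in_unit_itv).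

(* (0,1)^Z with the Borel sigma-algebra of the product topology. *)
Definition env_borel : set (set {ptws int -> unit_itv}) := open.
Definition env : Type := g_sigma_algebraType env_borel.

Definition omega (w : env) (i : int) : R := set_val (w i).

Definition rho (i : int) (w : env) : R := (1 - omega w i) / omega w i.

Definition env_shift (w : env) : env := fun i => w (i + 1).

Variable P : probability env R.

Definition stationary : Prop :=
  forall A : set env, measurable A -> P (env_shift @^-1` A) = P A.

Definition ergodic : Prop :=
  forall A : set env, measurable A -> env_shift @^-1` A = A ->
    P A = 0%E \/ P A = 1%E.

Definition sigma_coord (I : set int) : set (set env) :=
  <<s \bigcup_(i in I)
        preimage_set_system setT (fun w : env => omega w i) measurable >>.

Definition mixing (n : nat) : R :=
  sup [set x | exists A B : set env,
    [/\ sigma_coord [set i | i <= 0] A,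
        sigma_coord [set i | n%:Z <= i] B &
        x = `| fine (P (A `&` B)) - fine (P A) * fine (P B) | ] ].

Definition condA1 : Prop :=
  forall xi : R, 0 < xi ->
    cvgn (fun N : nat => \sum_(1 <= n < N) n%:R `^ xi * mixing n).

Definition Vbar (n : nat) (w : env) : R :=
  n%:R^-1 * \sum_(i < n) ln (rho i%:Z w).

(* [lne] is the extended logarithm, with [lne 0 = -oo]; the infimum over the
   empty set is [+oo]. *)
Definition satisfies_LDP (Y : nat -> env -> R) (J : R -> \bar R) : Prop :=
  forall A : set R, measurable A ->
    let u := fun n : nat => ((n%:R^-1)%:E * lne (P (Y n @^-1` A)))%E in
    [/\ (- ereal_inf (J @` A^°) <= limn_einf u)%E,
        (limn_einf u <= limn_esup u)%E &
        (limn_esup u <= - ereal_inf (J @` closure A))%E].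

Definition good_rate_function (J : R -> \bar R) : Prop :=
  (forall x, (0 <= J x)%E) /\
  (forall a : R, 0 < a -> compact (J @^-1` `[0%E, a%:E])).

Definition condA2 (J : R -> \bar R) : Prop :=
  good_rate_function J /\ satisfies_LDP Vbar J.

Definition log_moment (lambda : R) : \bar R :=
  limn_esup (fun n : nat => ((n%:R^-1)%:E *
    lne (\int[P]_w (\prod_(i < n) (rho i%:Z w `^ lambda))%:E))%E).

Definition condA3 : Prop := forall lambda : R, (log_moment lambda < +oo)%E.

Definition condA4 : Prop :=
  (0 <= log_moment 1)%E /\
  exists lambda1 : R, 0 < lambda1 /\ (log_moment lambda1 < 0)%E.

(* The minimum of J(y)/y over y > 0, as an infimum in the extended reals. *)
Definition kappa (J : R -> \bar R) : \bar R :=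
  ereal_inf [set (J y / y%:E)%E | y in [set y : R | 0 < y]].

End Environment.

HB.instance Definition _ := isPointed.Build int 0.

(* Integer-valued paths, with the sigma-algebra generated by the sets
   {X_n = i}, i.e. the cylinder sigma-algebra. *)
Definition coord_events : set (set (nat -> int)) :=
  [set C | exists n i, C = [set x : nat -> int | x n = i]].
Definition walk_path : Type := g_sigma_algebraType coord_events.

Section Walk.
Variable R : realType.

Definition transition (w : env R) (i j : int) : R :=
  if j == i + 1 then omega w i
  else if j == i - 1 then 1 - omega w i else 0.

(* The Markov property is stated as P(past, X_{n+1} = j) = P(past) p(i, j),
   where the past {X_0 = x_0, ..., X_n = x_n} has x_n = i, so that pasts of
   probability 0 need no convention.  This determines the law Q. *)
Definition quenched_law (w : env R) (Q : probability walk_path R) : Prop :=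
  Q [set x : walk_path | x 0%N = 0] = 1%E /\
  forall (n : nat) (h : nat -> int) (j : int),
    Q [set x : walk_path | (forall k, (k <= n)%N -> x k = h k) /\ x n.+1 = j] =
    (Q [set x : walk_path | forall k, (k <= n)%N -> x k = h k]
       * (transition w (h n) j)%:E)%E.

Definition annealed_law (P : probability (env R) R)
    (Pquenched : env R -> probability walk_path R)
    (PP : probability (env R * walk_path)%type R) : Prop :=
  forall (F : set (env R)) (G : set walk_path), measurable F -> measurable G ->
    PP (F `*` G) = (\int[P]_(w in F) Pquenched w G)%E.

(* The hitting time of n, equal to +oo when n is never visited. *)
Definition hitting_time (n : nat) (x : walk_path) : \bar R :=
  ereal_inf [set (i%:R)%:E | i in [set i : nat | x i = n%:Z]].

End Walk.

Section ConvergenceInProbability.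
Context {d : measure_display} {T : measurableType d} {R : realType}.
Variable P : probability T R.

Definition cvg_to0_in_probability (Y : nat -> T -> \bar R) : Prop :=
  forall e : R, 0 < e ->
    P [set t | e%:E < `|Y n t|]%E @[n --> \oo] --> 0%E.

Definition cvg_to_pinfty_in_probability (Y : nat -> T -> \bar R) : Prop :=
  forall M : R, P [set t | M%:E < Y n t]%E @[n --> \oo] --> 1%E.

End ConvergenceInProbability.

(* Main.v *)
Require Import Defs.
From HB Require Import structures.
From mathcomp Require Import all_boot all_order all_algebra.
From mathcomp Require Import all_classical all_reals all_analysis.
From mathcomp Require Import measurable_realfun lra ring zify.
Import Order.TTheory GRing.Theory Num.Theory numFieldNormedType.Exports.

Set Implicit Arguments.
Unset Strict Implicit.
Unset Printing Implicit Defensive.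

Local Open Scope classical_set_scope.
Local Open Scope ring_scope.

(** Write S_m for the sum of log rho_i over a block of m sites. Fast decay of
    the moments of exp(S_m) makes the walk fast; a block on which S_m is large
    is a barrier that makes it slow. Both effects are governed by J, and they
    balance at kappa.

    The walk enters through one finite quantity, survival N i: the quenched
    probability, from i, that the site b is not visited up to time N. It
    satisfies a two-term recursion in N, and two comparison arguments on that
    recursion replace the Markov property at hitting times, infinite expected
    crossing times and harmonic functions.

    Case alpha < kappa. The expectation of min(T_n, N+1) is at most
    a sum over k < n of truncated crossing times, each a sum of products of
    consecutive rho (total_survival, step_timeE). By the Markov inequality and
    the subadditivity of t^b for b <= 1, P(T_n > N) <= (N+1)^-b * n * 2C,
    where C bounds the series of the moments E exp(b S_j)
    (survival_powR, mean_survival_le). With alpha < b < kappa and N of order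
    n^(1/alpha) this tends to 0. The series converges because E exp(b S_j) decays
    exponentially for 0 < b < kappa: the negative log-moment of condA4 gives
    J(y) >= l y + e for some e > 0, the definition of kappa gives J(y) >= k y
    for some k > b, a convex combination is J(y) >= b y + c with c > 0 (rate_ge,
    moment_decay_below_kappa), and the upper half of Varadhan's lemma concludes
    (moment_decay_rate). The same argument at b = 1 contradicts the other half of
    condA4 unless kappa <= 1 (kappa_le1), which is why b <= 1 is no restriction.

    Case kappa < alpha. Choose y > 0 with J(y) < alpha y. A block of m sites
    has S_m > y m with probability at least exp(-b m), for b slightly above J(y).
    Take m = log n / th with b < th < alpha y: the barrier has height
    exp(y m) = n^(y / th), a power larger than n^(1/alpha), while exp(-b m) is a
    power of 1/n with exponent below 1. So among the blocks in [0, n), separated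
    by gaps of size n^d across which condA1 makes them almost independent, one is a
    barrier with high probability (low_blocks_bound). Each step of the walk has
    chance at most exp(-y m) to start a successful crossing of it
    (crossing_bound), hence the time n^(1/alpha) does not suffice
    (crossed_mean_bound, crossed_mean_cvg0). *)

(** * Nearest-neighbour walks: survival probabilities *)
Section NearestNeighbour.
Context {R : realFieldType}.
Variables (p : int -> R) (b : int).
Hypothesis p01 : forall i, 0 < p i < 1.

(** The probability, for the walk with up-probabilities p started at i, to avoid
    b at the times 0, ..., N. The value 0 is given beyond b as well as at b: a
    walk started to the left of b meets b before it can get there. *)
Fixpoint survival (N : nat) (i : int) : R :=
  if i < b then
    if N is N'.+1 then p i * survival N' (i + 1) + (1 - p i) * survival N' (i - 1)
    else 1
  else 0.

Definition odds (i : int) : R := (1 - p i) / p i.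

Lemma odds_ge0 i : 0 <= odds i.
Proof. by have /andP[? ?] := p01 i; rewrite divr_ge0 ?subr_ge0 // ltW. Qed.

Lemma survival_hit N i : b <= i -> survival N i = 0.
Proof. by case: N => [|N] /= bi; rewrite ltNge bi. Qed.

Lemma survivalS N i : i < b -> survival N.+1 i =
  p i * survival N (i + 1) + (1 - p i) * survival N (i - 1).
Proof. by move=> /= ->. Qed.

Lemma survival_itv N i : 0 <= survival N i <= 1.
Proof.
elim: N i => [|N IH] i /=; case: ifP; rewrite ?lexx ?ler01 // => _.
have /andP[? ?] := p01 i; have /andP[? ?] := IH (i + 1).
have /andP[? ?] := IH (i - 1); nra.
Qed.

Lemma survival_decrN N i : survival N.+1 i <= survival N i.
Proof.
elim: N i => [|N IH] i.
  rewrite [X in _ <= X]/=; case: ltP => [ib|bi].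
    by have /andP[] := survival_itv 1 i.
  by rewrite survival_hit.
case: (ltP i b) => [ib|bi]; last by rewrite !survival_hit.
rewrite (survivalS N.+1 ib) (survivalS N ib); have /andP[p0 p1] := p01 i.
by apply: lerD; apply: ler_wpM2l; rewrite ?IH ?subr_ge0 ?ltW.
Qed.

(** The induction goes through time N + 1 at i + 1: one step from i leads to
    i + 1 or further to the left, so survival N (i + 1) lies below
    survival N.+1 i, and it dominates survival N.+1 (i + 1). *)
Lemma survival_decr N i : survival N (i + 1) <= survival N i.
Proof.
elim: N i => [|N IH] i.
  have /andP[? ?] := survival_itv 0 (i + 1).
  rewrite [X in _ <= X]/=; case: ltP => [ib //|bi].
  by rewrite survival_hit // (le_trans bi) // lerDl.
case: (ltP i b) => [ib|bi]; last first.
  by rewrite !survival_hit // (le_trans bi) // lerDl.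
apply: le_trans (survival_decrN N (i + 1)) _; rewrite survivalS //.
have /andP[? ?] := p01 i.
have h1 := IH i; have h2 : survival N i <= survival N (i - 1).
  by have := IH (i - 1); rewrite subrK.
nra.
Qed.

Lemma survival_decr_nat N i k : survival N (i + k%:Z) <= survival N i.
Proof.
elim: k => [|k IH]; first by rewrite addr0.
by apply: le_trans IH; rewrite -addn1 PoszD addrA survival_decr.
Qed.

(** The recursion says that survival N.+1 i is an average of the two neighbouring
    values at time N; since it does not exceed survival N i, the weighted drop to
    the right of i outweighs the one to its left. *)
Lemma survival_drop N i : i < b ->
  odds i * (survival N (i - 1) - survival N i)
    <= survival N i - survival N (i + 1).
Proof.
move=> ib; have := survival_decrN N i; rewrite survivalS //.
have /andP[p0 p1] := p01 i => h; rewrite /odds mulrAC ler_pdivrMr //; nra.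
Qed.

Lemma survival_drop_block N a m : a + m%:Z < b ->
  (\prod_(j < m) odds (a + 1 + j%:Z)) * (survival N a - survival N (a + 1))
    <= survival N (a + m%:Z) - survival N (a + m%:Z + 1).
Proof.
elim: m => [|m IH] ab; first by rewrite big_ord0 mul1r addr0.
rewrite big_ord_recr /=.
have e : a + m.+1%:Z = a + 1 + m%:Z by rewrite -addn1 PoszD; ring.
have e' : a + 1 + m%:Z - 1 = a + m%:Z by ring.
rewrite e in ab *.
have := survival_drop N ab; rewrite e' => h.
have {}IH := IH (lt_trans _ ab).
apply: le_trans h.
rewrite mulrAC mulrC ler_wpM2l ?odds_ge0 //.
have -> : a + 1 + m%:Z = a + m%:Z + 1 by ring.
apply: IH; have -> : a + 1 + m%:Z = a + m%:Z + 1 by ring.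
by rewrite ltrDl.
Qed.

(** Total drops are at most 1, so after a product of odds at least c the drop at
    a is at most 1/c (survival_drop_block); one time step decreases the survival
    probability at a by no more than that drop. *)
Lemma crossing_bound N a m c : a + m%:Z < b -> 0 < c ->
  c <= \prod_(j < m) odds (a + 1 + j%:Z) ->
  1 - survival N a <= N%:R / c.
Proof.
move=> ab c0 hc; elim: N => [|N IH].
  rewrite mul0r /=.
  by rewrite (le_lt_trans _ ab) ?lerDl // subrr.
have ab' : a < b by rewrite (le_lt_trans _ ab) ?lerDl.
have h := survival_drop_block N ab.
have /andP[? ?] := survival_itv N (a + m%:Z).
have /andP[? ?] := survival_itv N (a + m%:Z + 1).
have h1 : c * (survival N a - survival N (a + 1)) <= 1.
  apply: (@le_trans _ _ (survival N (a + m%:Z) - survival N (a + m%:Z + 1))).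
    by apply: le_trans h; rewrite ler_wpM2r // subr_ge0 survival_decr.
  lra.
have h2 : survival N (a + 1) <= survival N.+1 a.
  rewrite survivalS //; have /andP[? ?] := p01 a.
  have := survival_decr N a; have := survival_decr N (a - 1); rewrite subrK.
  nra.
have h3 : survival N a - survival N (a + 1) <= c^-1.
  by rewrite -[c^-1]mul1r ler_pdivlMr // mulrC.
have -> : N.+1%:R / c = N%:R / c + c^-1 by rewrite -natr1 mulrDl mul1r.
lra.
Qed.

(** The expected time to go from k to k + 1 when the passage from k - d to
    k - d + 1 takes no time. This truncation keeps every sum finite, and depth
    N + 1 is enough for the first N steps. *)
Fixpoint step_time (d : nat) (k : int) : R :=
  if d is d'.+1 then 1 + odds k + odds k * step_time d' (k - 1) else 0.

Lemma step_time_ge0 d k : 0 <= step_time d k.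
Proof.
elim: d k => //= d IH k.
by rewrite addr_ge0 // ?(addr_ge0 ler01) ?(mulr_ge0 _ (IH _)) ?odds_ge0.
Qed.

Lemma step_time_incr d k : step_time d k <= step_time d.+1 k.
Proof.
elim: d k => [|d IH] k; first exact: step_time_ge0.
by rewrite /= lerD2l ler_wpM2l ?odds_ge0.
Qed.

(** The sum of survival l i over l <= N is the expectation of min(T_b, N+1), where
    T_b is the hitting time of b. Its recursion compares with the one of
    step_time, i.e. with p * D' = 1 + (1 - p) * D for the times D' from i to i + 1
    and D from i - 1 to i. *)
Lemma total_survival_step N i : i < b ->
  \sum_(l < N.+1) survival l i
    <= \sum_(l < N.+1) survival l (i + 1) + step_time N.+1 i.
Proof.
elim: N i => [|N IH] i ib.
  rewrite !big_ord_recl !big_ord0 !addr0.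
  have /andP[? ?] := survival_itv 0 i; have /andP[? ?] := survival_itv 0 (i + 1).
  have -> : step_time 1 i = 1 + odds i by rewrite /= mulr0 addr0.
  have := odds_ge0 i; lra.
rewrite big_ord_recl [in X in X + _ <= _]/= ib.
have -> : \sum_(l < N.+1) survival (bump 0 l) i =
    p i * (\sum_(l < N.+1) survival l (i + 1)) +
    (1 - p i) * \sum_(l < N.+1) survival l (i - 1).
  rewrite !mulr_sumr -big_split; apply: eq_bigr => l _.
  exact: survivalS.
have S1 := IH i ib.
have ib' : i - 1 < b by rewrite (lt_trans _ ib) // ltrBlDr ltrDl.
have S2 := IH (i - 1) ib'; rewrite subrK in S2.
have S3 : \sum_(l < N.+1) survival l (i + 1) <= \sum_(l < N.+2) survival l (i + 1).
  by rewrite [leRHS]big_ord_recr /= lerDl; have /andP[] := survival_itv N.+1 (i + 1).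
have D1 := step_time_incr N.+1 i.
have eD : p i * step_time N.+2 i = 1 + (1 - p i) * step_time N.+1 (i - 1).
  have -> : step_time N.+2 i = 1 + odds i + odds i * step_time N.+1 (i - 1) by [].
  rewrite /odds; move: (step_time _ _) => E; have /andP[p0 _] := p01 i.
  by field; rewrite gt_eqF.
have /andP[p0 p1] := p01 i.
move: S1 S2 S3 D1 eD.
set A := \sum_(l < N.+1) survival l i; set B := \sum_(l < N.+1) survival l (i + 1).
set C := \sum_(l < N.+1) survival l (i - 1); set B' := \sum_(l < N.+2) _.
set D := step_time N.+1 i; set D' := step_time N.+2 i; set E := step_time _ _.
move=> S1 S2 S3 D1 eD.
have h : (1 - p i) * C <= (1 - p i) * (B + D' + E).
  by apply: ler_wpM2l; lra.
nra.
Qed.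

Lemma total_survival N (n : nat) i : i + n%:Z = b ->
  \sum_(l < N.+1) survival l i <= \sum_(k < n) step_time N.+1 (i + k%:Z).
Proof.
elim: n i => [|n IH] i ib.
  rewrite big_ord0 big1 // => l _; rewrite survival_hit //.
  by rewrite -ib addr0.
rewrite [leRHS]big_ord_recl.
rewrite (_ : i + (ord0 : 'I_n.+1)%:Z = i); last exact: addr0.
have ib' : i < b by rewrite -ib ltrDl.
apply: le_trans (total_survival_step N ib') _; rewrite addrC lerD2l.
have -> : \sum_(k < n) step_time N.+1 (i + (bump 0 k)%:Z) =
          \sum_(k < n) step_time N.+1 (i + 1 + k%:Z).
  by apply: eq_bigr => k _; rewrite -[bump 0 k]/(1 + k)%N PoszD addrA.
by apply: IH; rewrite -ib -[n.+1]addn1 PoszD; ring.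
Qed.

Lemma survival_le_total N i :
  N.+1%:R * survival N i <= \sum_(l < N.+1) survival l i.
Proof.
have mono l k : survival (l + k) i <= survival l i.
  elim: k => [|k IH]; first by rewrite addn0.
  by rewrite addnS; exact: le_trans (survival_decrN _ _) IH.
rewrite mulr_natl -[X in _ *+ X]card_ord -sumr_const; apply: ler_sum => l _.
by rewrite -[X in survival X i <= _](subnKC (ltn_ord l : (l <= N)%N)).
Qed.

Lemma step_timeE d k : step_time d k =
  \sum_(j < d) (\prod_(l < j) odds (k - l%:Z) + \prod_(l < j.+1) odds (k - l%:Z)).
Proof.
elim: d k => [|d IH] k; first by rewrite big_ord0.
rewrite [LHS]/= IH big_ord_recl big_ord0 big_ord_recl big_ord0 mulr1 subr0.
congr (_ + _); rewrite mulr_sumr; apply: eq_bigr => j _.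
rewrite mulrDr /= /bump /= add1n; congr (_ + _).
  rewrite [RHS]big_ord_recl subr0; congr (_ * _); apply: eq_bigr => l _.
  by rewrite (_ : lift ord0 l = (1 + l)%N :> nat) // PoszD opprD addrA.
rewrite [RHS]big_ord_recl subr0; congr (_ * _); apply: eq_bigr => l _.
by rewrite (_ : lift ord0 l = (1 + l)%N :> nat) // PoszD opprD addrA.
Qed.

End NearestNeighbour.

(** * The quenched law of the walk *)
Section QuenchedLaw.
Context {R : realType}.

Definition cylinder (n : nat) (h : nat -> int) : set walk_path :=
  [set x | forall k, (k <= n)%N -> x k = h k].

Definition avoid (b : int) (N : nat) : set walk_path :=
  [set x | forall k, (k <= N)%N -> x k <> b].

Lemma measurable_coord n i : measurable [set x : walk_path | x n = i].
Proof. by apply: sub_sigma_algebra; exists n, i. Qed.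

Lemma measurable_cylinder n h : measurable (cylinder n h).
Proof.
have -> : cylinder n h =
    \bigcap_(k in `I_n.+1) [set x : walk_path | x k = h k].
  by apply/seteqP; split => x hx k; exact: hx.
by apply: bigcap_measurable => [|k _]; [exists 0%N|exact: measurable_coord].
Qed.

Lemma measurable_avoid b N : measurable (avoid b N).
Proof.
have -> : avoid b N =
    \bigcap_(k in `I_N.+1) ~` [set x : walk_path | x k = b].
  by apply/seteqP; split => x hx k; exact: hx.
apply: bigcap_measurable => [|k _]; first by exists 0%N.
by apply: measurableC; exact: measurable_coord.
Qed.

Lemma omega_itv (w : env R) i : 0 < omega w i < 1.
Proof. by have := set_valP (w i); rewrite /= in_itv. Qed.

Variables (w : env R) (Q : probability walk_path R).
Hypothesis Qlaw : quenched_law w Q.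

Let extend (h : nat -> int) (n : nat) (j : int) : nat -> int :=
  fun k => if (k <= n)%N then h k else j.

Let cylinder_extend n h j :
  cylinder n.+1 (extend h n j) = cylinder n h `&` [set x | x n.+1 = j].
Proof.
apply/seteqP; split => x /=.
  move=> hx; split => [k kn|].
    by rewrite hx ?(leqW kn) // /extend kn.
  by rewrite hx // /extend ltnn.
move=> [hx xj] k; rewrite leq_eqVlt ltnS => /orP[/eqP ->|kn].
  by rewrite /extend ltnn.
by rewrite /extend kn hx.
Qed.

Let quenched_step n h j :
  Q (cylinder n.+1 (extend h n j)) =
  (Q (cylinder n h) * (transition w (h n) j)%:E)%E.
Proof. by rewrite cylinder_extend; have [_ <-] := Qlaw. Qed.

(** The two one-step extensions of a cylinder carry all its mass, because the
    transition probabilities to the two neighbours add up to 1. *)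
Lemma quenched_split n h (A : set walk_path) : measurable A ->
  Q (cylinder n h `&` A) =
  (Q (cylinder n.+1 (extend h n (h n + 1)) `&` A) +
   Q (cylinder n.+1 (extend h n (h n - 1)) `&` A))%E.
Proof.
move=> mA; set U := cylinder _ (extend _ _ (_ + _)).
set D := cylinder _ (extend _ _ (_ - _)).
have mU : measurable U by exact: measurable_cylinder.
have mD : measurable D by exact: measurable_cylinder.
have mUD : measurable (U `|` D) by exact: measurableU.
have mC : measurable (cylinder n h) by exact: measurable_cylinder.
have neq : h n - 1 <> h n + 1.
  by move=> /addrI.
have UD0 : U `&` D = set0.
  rewrite -subset0 /U /D !cylinder_extend => x /= [[_ xu] [_ xd]].
  by apply: neq; rewrite -xu -xd.
have UDC : U `|` D `<=` cylinder n h.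
  by rewrite /U /D !cylinder_extend => x /= [[]|[]].
have QUD : Q (U `|` D) = Q (cylinder n h).
  apply: eq_trans (measureU _ mU mD UD0) _.
  apply: eq_trans (congr2 (fun a b => a + b)%E
    (quenched_step n h _) (quenched_step n h _)) _.
  rewrite /transition /= eqxx.
  rewrite (introF eqP neq) eqxx -muleDr ?fin_num_measure //.
  by rewrite -EFinD addrC subrK mule1.
have null : Q (cylinder n h `\` (U `|` D)) = 0%E.
  rewrite measureD ?(setIidr UDC) //; last by rewrite ltey_eq fin_num_measure.
  apply: eq_trans (congr1 (fun t => Q (cylinder n h) - t)%E QUD) _.
  by rewrite subee // fin_num_measure.
rewrite -measureU //; last 3 first.
- exact: measurableI.
- exact: measurableI.
- by rewrite setIACA UD0 set0I.
rewrite -setIUl.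
have -> : cylinder n h `&` A =
    (U `|` D) `&` A `|` (cylinder n h `\` (U `|` D)) `&` A.
  by rewrite -setIUl setDUK.
rewrite measureU0 //.
- exact: measurableI.
- by apply: measurableI => //; exact: measurableD.
- apply: (subset_measure0 _ _ (@subIsetl _ _ _) null).
  + by apply: measurableI => //; exact: measurableD.
  + exact: measurableD.
Qed.

(** Induction on the remaining time N: extending the past by one step reproduces
    the recursion of survival. *)
Lemma quenched_avoid_cylinder b N n h :
  (forall k, (k <= n)%N -> h k <> b) -> h n < b ->
  Q (cylinder n h `&` avoid b (n + N)) =
  (Q (cylinder n h) * (survival (omega w) b N (h n))%:E)%E.
Proof.
elim: N n h => [|N IH] n h hb hn.
  rewrite /= hn mule1 addn0; congr (Q _).
  by apply/setIidPl => x hx k kn; rewrite hx //; exact: hb.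
rewrite quenched_split; last exact: measurable_avoid.
have step j : (j < b) || (j == b) ->
    Q (cylinder n.+1 (extend h n j) `&` avoid b (n + N.+1)) =
    (Q (cylinder n h) * (transition w (h n) j)%:E *
     (survival (omega w) b N j)%:E)%E.
  move=> jb.
  have ej : extend h n j n.+1 = j by rewrite /extend ltnn.
  case/orP: jb => [jb|/eqP jb].
    rewrite -addSnnS IH ?quenched_step ?ej // => k.
    rewrite leq_eqVlt ltnS => /orP[/eqP ->|kn].
      by rewrite ej => jb'; rewrite jb' ltxx in jb.
    by rewrite /extend kn; exact: hb.
  rewrite survival_hit ?jb // mule0.
  rewrite (_ : _ `&` _ = set0) ?measure0 //.
  rewrite -subset0 => x [/(_ n.+1 (leqnn _)) xn /(_ n.+1)].
  by apply; [rewrite addnS ltnS leq_addr|rewrite xn -jb].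
rewrite !step; last 2 first.
- by rewrite (lt_trans _ hn) // ltrBlDr ltrDl.
- by rewrite orbC -le_eqVlt lezD1.
rewrite survivalS // EFinD !EFinM muleDr ?fin_num_measure //;
  last exact: measurable_cylinder.
have -> : transition w (h n) (h n + 1) = omega w (h n).
  by rewrite /transition eqxx.
have -> : transition w (h n) (h n - 1) = 1 - omega w (h n).
  rewrite /transition eqxx ifF //; by apply/eqP => /addrI.
by rewrite !muleA.
Qed.

Lemma quenched_avoid b N : 0 < b ->
  Q (avoid b N) = (survival (omega w) b N 0)%:E.
Proof.
move=> b0; have Q0 : Q (cylinder 0 (fun=> 0)) = 1%E.
  have [<- _] := Qlaw; congr (Q _); apply/seteqP; split => x /=.
    by move/(_ 0%N); exact.
  by move=> x0 k; rewrite leqn0 => /eqP ->.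
have -> : Q (avoid b N) = Q (cylinder 0 (fun=> 0) `&` avoid b (0 + N)).
  have mC := measurable_cylinder 0 (fun=> 0).
  have := probability_setC Q mC; rewrite Q0 subee // => QC.
  rewrite add0n setIC -[in LHS](setIT (avoid b N)).
  rewrite -(setUv (cylinder 0 (fun=> 0))).
  rewrite setIUr measureU0 //.
  - by apply: measurableI => //; exact: measurable_avoid.
  - by apply: measurableI; [exact: measurable_avoid|exact: measurableC].
  - apply: (subset_measure0 _ _ (@subIsetr _ _ _) QC).
    + by apply: measurableI; [exact: measurable_avoid|exact: measurableC].
    + exact: measurableC.
rewrite quenched_avoid_cylinder // ?Q0 ?mul1e // => k _ b0'.
by rewrite -b0' ltxx in b0.
Qed.

End QuenchedLaw.

(** * The environment: measurability and stationarity *)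
Lemma continuous_into_product (X : topologicalType) (I : Type)
  (K : I -> topologicalType) (f : X -> prod_topology K) :
  (forall i, continuous (fun x => f x i)) -> continuous f.
Proof.
move=> fc x.
apply/cvg_sup => i U.
have /= -> := @nbhsE (initial_topology (fun g : (forall i, K i) => g i)) (f x).
move=> [_ [[C oC <-] Cfx]] /filterS; apply.
by apply: (fc i x); rewrite nbhsE; exists C.
Qed.

Section EnvironmentMeasurability.
Context {R : realType}.

Definition translate (z : int) (w : env R) : env R := fun i => w (i + z).

Lemma omega_translate z w i : omega (translate z w) i = omega w (i + z).
Proof. by []. Qed.

Lemma measurable_translate z : measurable_fun setT (translate z).
Proof.
apply: (@measurability _ _ (env R) (env R) setT _ (@env_borel R) erefl).
move=> _ [A oA <-]; rewrite setTI.
apply: sub_sigma_algebra.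
suff : continuous (translate z : {ptws int -> unit_itv R} -> {ptws int -> unit_itv R}).
  by move=> /continuousP; exact.
apply: continuous_into_product => t.
exact: (@proj_continuous _ (fun=> unit_itv R) (t + z)).
Qed.

Lemma measurable_omega i : measurable_fun setT (fun w : env R => omega w i).
Proof.
apply: (measurability _ (RGenOpens.measurableE R)) => _ [_ [a [b ->] <-]].
rewrite setTI; apply: sub_sigma_algebra.
suff : continuous (fun w : {ptws int -> unit_itv R} => omega w i : R^o).
  by move=> /continuousP; apply; exact: interval_open.
move=> w; apply: (@continuous_comp _ _ _ (fun g : {ptws int -> unit_itv R} => g i)
   (@set_val _ _)).
  exact: (@proj_continuous _ (fun=> unit_itv R) i w).
exact: initial_continuous.
Qed.

Definition log_prod_rho (a : int) (m : nat) (w : env R) : R :=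
  \sum_(j < m) ln (rho (a + j%:Z) w).

Lemma log_prod_rho_translate z a m w :
  log_prod_rho a m (translate z w) = log_prod_rho (a + z) m w.
Proof.
by apply: eq_bigr => j _; rewrite /rho !omega_translate addrAC.
Qed.

Lemma rho_gt0 i w : 0 < rho i w :> R.
Proof.
by have /andP[? ?] := omega_itv w i; rewrite /rho divr_gt0 ?subr_gt0.
Qed.

Lemma expR_log_prod_rho a m w :
  expR (log_prod_rho a m w) = \prod_(j < m) rho (a + j%:Z) w.
Proof.
rewrite /log_prod_rho expR_sum; apply: eq_bigr => j _.
by rewrite lnK // posrE rho_gt0.
Qed.

Lemma log_prod_rho_cat a m n w :
  log_prod_rho a (m + n) w = log_prod_rho a m w + log_prod_rho (a + m%:Z) n w.
Proof.
rewrite /log_prod_rho big_split_ord /=; congr (_ + _).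
by apply: eq_bigr => j _; rewrite PoszD addrA.
Qed.

(** Stated for an arbitrary sigma-algebra, since it serves both for the Borel sets
    and for the sigma-algebras of subsets of the coordinates. *)
Lemma measurable_log_prod_rho d (T : measurableType d) (f : T -> env R) a m :
  (forall j, (j < m)%N -> measurable_fun setT (fun t => omega (f t) (a + j%:Z))) ->
  measurable_fun setT (fun t => log_prod_rho a m (f t)).
Proof.
move=> mf; rewrite /log_prod_rho.
apply: measurable_sum => j.
have -> : (fun t => ln (rho (a + j%:Z) (f t))) =
   (fun t => ln (1 - omega (f t) (a + j%:Z)) - ln (omega (f t) (a + j%:Z))).
  apply/funext => t; rewrite /rho.
  by have /andP[? ?] := omega_itv (f t) (a + j%:Z); rewrite ln_div // posrE ?subr_gt0.
have mw := mf j (ltn_ord j).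
apply: measurable_funB; apply: (measurableT_comp (@measurable_ln R)) => //.
by apply: measurable_funB => //.
Qed.

Lemma measurable_survival b N i :
  measurable_fun setT (fun w : env R => survival (omega w) b N i).
Proof.
elim: N i => [|N IH] i /=; case: (i < b); try exact: measurable_cst.
apply: measurable_funD; apply: measurable_funM => //.
- exact: measurable_omega.
- by apply: measurable_funB => //; exact: measurable_omega.
Qed.

End EnvironmentMeasurability.

Section Stationarity.
Context {R : realType} (P : probability (env R) R).
Hypothesis P_stationary : stationary P.

(** Stationarity concerns the shift by 1; a shift by a negative z is handled by
    applying the positive shift by - z to the shifted event. *)
Lemma translate_invariant z (A : set (env R)) : measurable A ->
  P (translate z @^-1` A) = P A.
Proof.
have mpre k B : measurable B -> measurable (@translate R k @^-1` B).
  by move=> mB; rewrite -[_ @^-1` _]setTI; exact: measurable_translate.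
have nneg (n : nat) B : measurable B -> P (translate n%:Z @^-1` B) = P B.
  elim: n B => [|n IH] B mB.
    congr (P _); apply/seteqP; split => w /=; rewrite /preimage /= /translate.
      by under eq_fun do rewrite addr0.
    by under eq_fun do rewrite addr0.
  rewrite -(IH B mB) -[in RHS](P_stationary (mpre _ _ mB)); congr (P _).
  apply/seteqP; split => w /=; rewrite /preimage /= /translate /env_shift.
    by under eq_fun do rewrite -addn1 PoszD addrA.
  by under [X in _ -> B X]eq_fun do rewrite -addn1 PoszD addrA.
case: z => n mA; first exact: nneg.
rewrite NegzE -[LHS](nneg n.+1) ?mpre //; last exact: mpre.
congr (P _); apply/seteqP; split => w /=; rewrite /preimage /= /translate.
  by under eq_fun do rewrite addrNK.
by under [X in _ -> A X]eq_fun do rewrite addrNK.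
Qed.

Lemma integral_translate z (f : env R -> \bar R) :
  measurable_fun setT f -> (forall w, 0 <= f w)%E ->
  (\int[P]_w f (translate z w) = \int[P]_w f w)%E.
Proof.
move=> mf f0.
have := @ge0_integral_pushforward _ _ (env R) (env R) R _ (measurable_translate z) P
  setT f measurableT mf (fun y _ => f0 y).
rewrite preimage_setT => <-.
apply: eq_measure_integral; first exact: measurable_translate.
by move=> ? A mA _; exact: translate_invariant.
Qed.

End Stationarity.

(** * Exponential scale and expectations *)
Section ExponentialScale.
Context {R : realType}.
Implicit Types (x y u : nat -> \bar R) (c : R).

Lemma lte_real_between (a b : \bar R) : (a < b)%E ->
  exists c : R, (a < c%:E < b)%E.
Proof.
move: a b => [a| |] [b| |] //=; rewrite ?lte_fin => ab.
- by exists ((a + b) / 2); rewrite !lte_fin !midf_lt.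
- by exists (a + 1); rewrite lte_fin ltrDl ltr01 ltry.
- by exists (b - 1); rewrite ltNyr lte_fin gtrBl ltr01.
- by exists 0; rewrite ltNyr ltry.
Qed.

Lemma limn_esup_lt u (c : \bar R) : (limn_esup u < c)%E ->
  \forall n \near \oo, (u n < c)%E.
Proof.
move=> /ereal_inf_lt[_ [A A_near <-] supA]; apply: filterS A_near => n An.
by apply: le_lt_trans supA; apply: ereal_sup_ubound; exists n.
Qed.

Lemma lt_limn_einf u (c : \bar R) : (c < limn_einf u)%E ->
  \forall n \near \oo, (c < u n)%E.
Proof.
rewrite /limn_einf lteNr => /limn_esup_lt; apply: filterS => n.
by rewrite lteN2.
Qed.

Lemma limn_esup_le u (c : \bar R) : (\forall n \near \oo, (u n <= c)%E) ->
  (limn_esup u <= c)%E.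
Proof.
move=> uc; apply: (@le_trans _ _ (ereal_sup (u @` [set n | (u n <= c)%E]))).
  by apply: ereal_inf_lbound; exists [set n | (u n <= c)%E].
by apply: ge_ereal_sup => _ [n un <-].
Qed.

Lemma lne_scale_lt (n : nat) (x : \bar R) c : (0 < n)%N ->
  (n%:R^-1%:E * lne x < c%:E)%E = (x < (expR (c * n%:R))%:E)%E.
Proof.
move=> n0; have n0' : 0 < n%:R :> R by rewrite ltr0n.
rewrite lte_pdivrMl // -EFinM mulrC; case: x => [r| |].
- case: (ltP 0 r) => r0.
    by rewrite lne_EFin // !lte_fin -ltr_expR lnK.
  by rewrite le0_lneNy ?lee_fin // ltNyr lte_fin (le_lt_trans r0) // expR_gt0.
- by [].
- by rewrite ltNyr ltNyr.
Qed.

Lemma lt_lne_scale (n : nat) (x : \bar R) c : (0 < n)%N ->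
  (c%:E < n%:R^-1%:E * lne x)%E = ((expR (c * n%:R))%:E < x)%E.
Proof.
move=> n0; have n0' : 0 < n%:R :> R by rewrite ltr0n.
rewrite lte_pdivlMl // -EFinM mulrC; case: x => [r| |].
- case: (ltP 0 r) => r0.
    by rewrite lne_EFin // !lte_fin -ltr_expR lnK.
  rewrite le0_lneNy ?lee_fin //; symmetry; apply/negbTE.
  by rewrite lte_fin -leNgt (le_trans r0) // expR_ge0.
- by rewrite !ltry.
- by [].
Qed.

Lemma limn_esup_log_lt x c :
  (limn_esup (fun n => n%:R^-1%:E * lne (x n)) < c%:E)%E ->
  \forall n \near \oo, (x n < (expR (c * n%:R))%:E)%E.
Proof.
move=> /limn_esup_lt xc; near=> n.
rewrite -lne_scale_lt; last by near: n; exact: nbhs_infty_gt.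
by near: n.
Unshelve. all: by end_near. Qed.

Lemma lt_limn_einf_log x c :
  (c%:E < limn_einf (fun n => n%:R^-1%:E * lne (x n)))%E ->
  \forall n \near \oo, ((expR (c * n%:R))%:E < x n)%E.
Proof.
move=> /lt_limn_einf xc; near=> n.
rewrite -lt_lne_scale; last by near: n; exact: nbhs_infty_gt.
by near: n.
Unshelve. all: by end_near. Qed.

Definition exp_decay x :=
  exists2 e : R, 0 < e & \forall n \near \oo, (x n <= (expR (- e * n%:R))%:E)%E.

Lemma limn_esup_log_lt0 x :
  (limn_esup (fun n => n%:R^-1%:E * lne (x n)) < 0)%E -> exp_decay x.
Proof.
move=> /lte_real_between[c /andP[xc c0]]; exists (- c).
  by rewrite oppr_gt0 -lte_fin.
by rewrite opprK; apply: filterS (limn_esup_log_lt xc) => n /ltW.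
Qed.

Lemma exp_decay_limn_esup x : exp_decay x ->
  (limn_esup (fun n => n%:R^-1%:E * lne (x n)) < 0)%E.
Proof.
move=> [e e0 xe]; apply: (@le_lt_trans _ _ (- (e / 2))%:E); last first.
  by rewrite lte_fin oppr_lt0 divr_gt0.
apply: limn_esup_le; near=> n.
have n0 : (0 < n)%N by near: n; exact: nbhs_infty_gt.
apply: ltW; rewrite lne_scale_lt //.
apply: (@le_lt_trans _ _ (expR (- e * n%:R))%:E); first by near: n.
rewrite lte_fin ltr_expR ltr_pM2r ?ltr0n // ltrN2 ltr_pdivrMr //.
by rewrite ltr_pMr // ltr1n.
Unshelve. all: by end_near. Qed.

Lemma expR_ge_near (K e : R) : 0 < e ->
  \forall n \near \oo, K <= expR (e * n%:R).
Proof.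
move=> e0; near=> n.
apply: le_trans (expR_ge1Dx _); rewrite -[K]add0r lerD //.
rewrite mulrC -ler_pdivrMr //.
by near: n; exact: nbhs_infty_ger.
Unshelve. all: by end_near. Qed.

Lemma exp_decay_mul x (K e : R) : 0 < e ->
  (\forall n \near \oo, (x n <= (K * expR (- e * n%:R))%:E)%E) -> exp_decay x.
Proof.
move=> e0 xe; exists (e / 2); first by rewrite divr_gt0.
near=> n; apply: (@le_trans _ _ (K * expR (- e * n%:R))%:E); first by near: n.
rewrite lee_fin (_ : - (e / 2) * n%:R = e / 2 * n%:R + - e * n%:R); last by field.
rewrite expRD ler_wpM2r ?expR_ge0 //.
by near: n; apply: expR_ge_near; rewrite divr_gt0.
Unshelve. all: by end_near. Qed.

End ExponentialScale.

Section Expectation.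
Context {d : measure_display} {T : measurableType d} {R : realType}.
Variable P : probability T R.
Implicit Types (f g : T -> R).

Definition mean f : \bar R := (\int[P]_t (f t)%:E)%E.

Lemma mean_le f g : measurable_fun setT f -> measurable_fun setT g ->
  (forall t, 0 <= f t <= g t) -> (mean f <= mean g)%E.
Proof.
move=> mf mg fg; apply: ge0_le_integral => //.
- by move=> t _; rewrite lee_fin; have /andP[] := fg t.
- exact/measurable_EFinP.
- exact/measurable_EFinP.
- by move=> t _; rewrite lee_fin; have /andP[] := fg t.
Qed.

Lemma meanD f g : measurable_fun setT f -> measurable_fun setT g ->
  (forall t, 0 <= f t) -> (forall t, 0 <= g t) ->
  mean (fun t => f t + g t) = (mean f + mean g)%E.
Proof.
move=> mf mg f0 g0; rewrite /mean; under eq_integral do rewrite EFinD.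
by rewrite ge0_integralD //; try exact/measurable_EFinP; move=> t _; rewrite lee_fin.
Qed.

Lemma meanZ f (c : R) : measurable_fun setT f -> (forall t, 0 <= f t) ->
  0 <= c -> mean (fun t => c * f t) = (c%:E * mean f)%E.
Proof.
move=> mf f0 c0; rewrite /mean; under eq_integral do rewrite EFinM.
rewrite ge0_integralZl_EFin //; last exact/measurable_EFinP.
by move=> t _; rewrite lee_fin.
Qed.

Lemma mean_sum (n : nat) (f : nat -> T -> R) :
  (forall i, measurable_fun setT (f i)) -> (forall i t, 0 <= f i t) ->
  mean (fun t => \sum_(i < n) f i t) = (\sum_(i < n) mean (f i))%E.
Proof.
move=> mf f0; rewrite /mean; under eq_integral do rewrite -sumEFin.
rewrite (ge0_integral_sum _ _ (f := fun (i : 'I_n) t => (f i t)%:E)) //.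
- by move=> i; exact/measurable_EFinP.
- by move=> i t _; rewrite lee_fin.
Qed.

Lemma mean_cst (c : R) : mean (fun=> c) = c%:E.
Proof.
apply: eq_trans (integral_cst P measurableT c%:E) _.
apply: eq_trans (congr1 (fun y => c%:E * y)%E (probability_setT P)) _.
by rewrite mule1.
Qed.

Lemma mean_indic (A : set T) : measurable A -> mean (\1_A) = P A.
Proof. by move=> mA; rewrite /mean integral_indic // setIT. Qed.

Lemma mean_ge0 f : (forall t, 0 <= f t) -> (0 <= mean f)%E.
Proof. by move=> f0; apply: integral_ge0 => t _; rewrite lee_fin. Qed.

Lemma mean_markov f (A : set T) (c : R) : measurable_fun setT f ->
  (forall t, 0 <= f t) -> measurable A -> 0 <= c ->
  (forall t, A t -> c <= f t) -> (c%:E * P A <= mean f)%E.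
Proof.
move=> mf f0 mA c0 cf; rewrite -mean_indic // -meanZ //.
apply: mean_le => //; first by apply: measurable_funM.
move=> t; rewrite indicE; have [/set_mem/cf cft|tA] := boolP (t \in A).
  by rewrite mulr1 c0.
by rewrite mulr0 lexx f0.
Qed.

End Expectation.

(** * Moments and large deviations of log-products *)
Section Moments.
Context {R : realType} (P : probability (env R) R).

Lemma measurable_log_prod a m :
  measurable_fun setT (fun w : env R => log_prod_rho a m w).
Proof.
apply: (measurable_log_prod_rho (f := id)) => j _; exact: measurable_omega.
Qed.

Lemma measurable_exp_log_prod (l : R) a m :
  measurable_fun setT (fun w : env R => expR (l * log_prod_rho a m w)).
Proof.
apply: measurableT_comp => //; apply: measurable_funM => //.
exact: measurable_log_prod.
Qed.

Definition moment (l : R) (n : nat) : \bar R :=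
  mean P (fun w => expR (l * log_prod_rho 0 n w)).

Lemma log_momentE l :
  log_moment P l = limn_esup (fun n => n%:R^-1%:E * lne (moment l n))%E.
Proof.
rewrite /log_moment; congr limn_esup; apply/funext => n; congr (_ * lne _)%E.
apply: eq_integral => w _; congr EFin.
rewrite mulr_sumr expR_sum; apply: eq_bigr => j _.
by rewrite /powR gt_eqF ?rho_gt0 // add0r.
Qed.

Lemma moment_translate (P_stationary : stationary P) l a n :
  mean P (fun w => expR (l * log_prod_rho a n w)) = moment l n.
Proof.
rewrite -[RHS](integral_translate P_stationary a).
- apply: eq_integral => w _; congr EFin.
  by rewrite log_prod_rho_translate add0r.
- by apply/measurable_EFinP; exact: measurable_exp_log_prod.
- by move=> w; rewrite lee_fin expR_ge0.
Qed.

(** A log-moment says nothing about small n. Write S_n = S_{n+N} - S', with N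
    large and S' the sum over the last N sites; then
    exp(l S_n) <= exp(2 l S_{n+N}) + exp(-2 l S'), and both terms are controlled
    by condA3, at 2l and -2l. *)
Lemma moment_finite (P_stationary : stationary P) : condA3 P ->
  forall l n, (moment l n < +oo)%E.
Proof.
move=> A3 l n.
have fin k : exists N, forall m, (N <= m)%N -> (moment k m < +oo)%E.
  have := A3 k; rewrite log_momentE => /lte_real_between[c /andP[/limn_esup_log_lt]].
  move=> [N _ hN] _; exists N => m Nm.
  by apply: (lt_trans (hN m Nm)); rewrite ltry.
have [N1 h1] := fin (2 * l); have [N2 h2] := fin (- (2 * l)).
pose N := maxn N1 N2.
apply: (@le_lt_trans _ _ (moment (2 * l) (n + N) + moment (- (2 * l)) N)%E).
  rewrite -(moment_translate P_stationary (- (2 * l)) n%:Z) /moment -meanD;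
    try (exact: measurable_exp_log_prod); try (by move=> w; rewrite expR_ge0).
  apply: mean_le; first exact: measurable_exp_log_prod.
    by apply: measurable_funD; exact: measurable_exp_log_prod.
  move=> w; rewrite expR_ge0 /= log_prod_rho_cat add0r.
  set x := log_prod_rho 0 n w; set y := log_prod_rho _ N w.
  have -> : l * x = l * (x + y) + - l * y by ring.
  have -> : 2 * l * (x + y) = l * (x + y) + l * (x + y) by ring.
  have -> : - (2 * l) * y = - l * y + - l * y by ring.
  rewrite !expRD; move: (expR_ge0 (l * (x + y))) (expR_ge0 (- l * y)).
  set p := expR _; set q := expR (- l * y) => p0 q0.
  have := sqr_ge0 (p - q); nra.
apply: lte_add_pinfty; [apply: h1|apply: h2]; last exact: leq_maxr.
exact: leq_trans (leq_maxl _ _) (leq_addl _ _).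
Qed.

(** With t = exp(S_n), cut at t = exp(-s): t^b <= exp(-b s) below, and
    t^b <= exp((l - b) s) t^l above. A level s proportional to n, small enough for
    the decay of t^l to absorb exp((l - b) s), gives decay of both. *)
Lemma moment_decay_small (l b : R) : 0 < b <= l ->
  exp_decay (moment l) -> exp_decay (moment b).
Proof.
move=> /andP[b0 bl] [e e0 hl].
have l0 : 0 < l by exact: lt_le_trans b0 bl.
pose dl := e / (2 * l).
have dl0 : 0 < dl by rewrite divr_gt0 // mulr_gt0.
pose e' := b * dl.
have e'0 : 0 < e' by rewrite mulr_gt0.
apply: (@exp_decay_mul _ _ 2 e') => //; near=> n.
pose s := n%:R * dl.
have bnd : (moment b n <=
    (expR (- b * s))%:E + (expR ((l - b) * s))%:E * moment l n)%E.
  rewrite -(mean_cst P (expR (- b * s))) -meanZ ?expR_ge0 //; last first.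
    exact: measurable_exp_log_prod.
  rewrite -meanD //; last first.
    by apply: measurable_funM => //; exact: measurable_exp_log_prod.
  apply: mean_le; first exact: measurable_exp_log_prod.
    apply: measurable_funD => //; apply: measurable_funM => //.
    exact: measurable_exp_log_prod.
  move=> w; rewrite expR_ge0 /= -expRD.
  set x := log_prod_rho 0 n w; case: (leP x (- s)) => xs.
    apply: ler_wpDr; first exact: expR_ge0.
    rewrite ler_expR mulNr -mulrN ler_wpM2l // ltW //.
  apply: ler_wpDl; first exact: expR_ge0.
  rewrite ler_expR.
  have : 0 <= (l - b) * (s + x) by rewrite mulr_ge0 ?subr_ge0 //; lra.
  lra.
apply: le_trans bnd _.
have hn : (moment l n <= (expR (- e * n%:R))%:E)%E by near: n.
apply: (@le_trans _ _ ((expR (- b * s))%:E +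
  (expR ((l - b) * s))%:E * (expR (- e * n%:R))%:E)%E).
  by rewrite leeD2l // lee_wpmul2l // lee_fin expR_ge0.
rewrite -EFinM -EFinD lee_fin -expRD.
have -> : - b * s = - e' * n%:R by rewrite /s /e'; ring.
have : expR ((l - b) * s + - e * n%:R) <= expR (- e' * n%:R).
  rewrite ler_expR /s /e'.
  have -> : (l - b) * (n%:R * dl) + - e * n%:R =
    - (b * dl) * n%:R - (e - l * dl) * n%:R by ring.
  have -> : l * dl = e / 2 by rewrite /dl; field; rewrite gt_eqF.
  by rewrite gerBl mulr_ge0 // subr_ge0 ler_pdivrMr // ler_pMr // ler1n.
lra.
Unshelve. all: by end_near. Qed.

End Moments.

Section LargeDeviations.
Context {R : realType} (P : probability (env R) R) (J : R -> \bar R).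
Hypothesis ldp : satisfies_LDP P (@Vbar R) J.

Let VbarE (n : nat) : Vbar n = fun w : env R => log_prod_rho 0 n w / n%:R.
Proof.
apply/funext => w; rewrite /Vbar /log_prod_rho mulrC; congr (_ / _).
Qed.

Lemma ldp_lower y (b d : R) : (J y < b%:E)%E -> 0 < d ->
  \forall n \near \oo,
    ((expR (- b * n%:R))%:E
      < P [set w : env R | (y - d) * n%:R < log_prod_rho 0 n w]%R)%E.
Proof.
move=> Jb d0; pose A : set R := `]y - d, +oo[%classic.
have [lo _ _] := ldp (measurable_itv `]y - d, +oo[).
have /lt_limn_einf_log : ((- b)%:E < limn_einf (fun n : nat =>
    (n%:R^-1)%:E * lne (P (Vbar n @^-1` A))))%E.
  apply: lt_le_trans lo; rewrite EFinN lteN2; apply: le_lt_trans Jb.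
  apply: ereal_inf_lbound; exists y => //.
  rewrite (interior_id _).1; first by rewrite /= in_itv /= andbT gtrBl.
  exact: interval_open.
move=> h; near=> n.
have n0 : (0 < n)%N by near: n; exact: nbhs_infty_gt.
rewrite [X in P X](_ : _ = Vbar n @^-1` A); first by near: n.
rewrite VbarE /A; apply/seteqP; split => w /=.
  by rewrite in_itv /= andbT ltr_pdivlMr ?ltr0n.
by rewrite in_itv /= andbT ltr_pdivlMr ?ltr0n.
Unshelve. all: by end_near. Qed.

Lemma ldp_upper y (a b : R) : (forall z, y <= z -> (b%:E <= J z)%E) -> a < b ->
  \forall n \near \oo,
    (P [set w : env R | y * n%:R <= log_prod_rho 0 n w]%R
      < (expR (- a * n%:R))%:E)%E.
Proof.
move=> bJ ab; pose A : set R := `[y, +oo[%classic.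
have [_ _ up] := ldp (measurable_itv `[y, +oo[).
have /limn_esup_log_lt : (limn_esup (fun n : nat =>
    (n%:R^-1)%:E * lne (P (Vbar n @^-1` A))) < (- a)%:E)%E.
  apply: le_lt_trans up _; rewrite EFinN lteN2.
  apply: (@lt_le_trans _ _ b%:E); first by rewrite lte_fin.
  apply: le_ereal_inf_tmp => _ [z + <-].
  rewrite -(closure_id _).1; last exact: interval_closed.
  by rewrite /= in_itv /= andbT => /bJ.
move=> h; near=> n.
have n0 : (0 < n)%N by near: n; exact: nbhs_infty_gt.
rewrite [X in P X](_ : _ = Vbar n @^-1` A); first by near: n.
rewrite VbarE /A; apply/seteqP; split => w /=.
  by rewrite in_itv /= andbT ler_pdivlMr ?ltr0n.
by rewrite in_itv /= andbT ler_pdivlMr ?ltr0n.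
Unshelve. all: by end_near. Qed.

Lemma measurable_high (c : R) a m :
  measurable [set w : env R | c < log_prod_rho a m w].
Proof.
rewrite -[X in measurable X]setTI.
have := @measurable_log_prod R a m measurableT `]c, +oo[%classic (measurable_itv _).
congr (measurable (_ `&` _)).
by apply/seteqP; split => w /=; rewrite in_itv /= andbT.
Qed.

Lemma measurable_high_large (c : R) a m :
  measurable [set w : env R | c <= log_prod_rho a m w].
Proof.
rewrite -[X in measurable X]setTI.
have := @measurable_log_prod R a m measurableT `[c, +oo[%classic (measurable_itv _).
congr (measurable (_ `&` _)).
by apply/seteqP; split => w /=; rewrite in_itv /= andbT.
Qed.

(** Chebyshev's inequality bounds the probability of S_n > (y - d) n by
    exp(- (l (y - d) + c) n), while the lower large-deviation bound makes it at
    least exp(- b n) for any b > J(y). *)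
Lemma rate_ge (l c : R) : 0 < l ->
  (\forall n \near \oo, (moment P l n <= (expR (- c * n%:R))%:E)%E) ->
  forall y, ((l * y + c)%:E <= J y)%E.
Proof.
move=> l0 hm y; rewrite leNgt; apply/negP => Jy.
have [b /andP[Jb]] := lte_real_between Jy; rewrite lte_fin => bl.
(* half of the room between b and l y + c, measured in units of the slope l *)
pose d := (l * y + c - b) / (2 * l).
have d0 : 0 < d by rewrite divr_gt0 ?mulr_gt0 ?subr_gt0.
have lo := ldp_lower Jb d0.
suff : \forall n \near \oo, False by case=> N _ /(_ N (leqnn N)).
near=> n.
have n0 : (0 < n)%N by near: n; exact: nbhs_infty_gt.
have lon : ((expR (- b * n%:R))%:E
      < P [set w : env R | (y - d) * n%:R < log_prod_rho 0 n w]%R)%E by near: n.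
have upn : (moment P l n <= (expR (- c * n%:R))%:E)%E by near: n.
have mk := mean_markov P (measurable_exp_log_prod l 0 n)
  (fun=> expR_ge0 _) (measurable_high ((y - d) * n%:R) 0 n)
  (expR_ge0 (l * ((y - d) * n%:R))).
have : ((expR (l * ((y - d) * n%:R)))%:E * (expR (- b * n%:R))%:E
   < (expR (- c * n%:R))%:E)%E.
  apply: lt_le_trans upn; apply: lt_le_trans (mk _); last first.
    by move=> w /= hw; rewrite ler_expR ler_pM2l // ltW.
  by rewrite lte_pmul2l // lte_fin expR_gt0.
rewrite -EFinM -expRD lte_fin ltr_expR => h1.
have h2 : l * d * 2 = l * y + c - b by rewrite /d; field; rewrite gt_eqF.
have : 0 < n%:R :> R by rewrite ltr0n.
have : 0 <= l * d by rewrite mulr_ge0 // ltW.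
nra.
Unshelve. all: by end_near. Qed.

End LargeDeviations.

Lemma near_forall_lt (K : nat) (Q : nat -> nat -> Prop) :
  (forall j, \forall n \near \oo, Q j n) ->
  \forall n \near \oo, forall j, (j < K)%N -> Q j n.
Proof.
move=> hQ; elim: K => [|K IH]; first by apply: nearW.
apply: filterS2 IH (hQ K) => n IHn QK j.
by rewrite ltnS leq_eqVlt => /orP[/eqP ->|/IHn].
Qed.

(** Slices of width d starting at level -d reduce an exponential moment to finitely
    many tail probabilities; above level c the larger exponent b + 1 takes over. *)
Lemma expR_slab_bound (R : realType) (b d c x : R) (K : nat) :
  0 < b -> 0 < d -> c <= d * K%:R - d ->
  forall n : R, 0 < n ->
  expR (b * x) <= expR (- (b * d) * n)
    + \sum_(j < K) expR (b * (d * j%:R) * n) * (- d + d * j%:R <= x / n)%R%:R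
    + expR (- c * n) * expR ((b + 1) * x).
Proof.
move=> b0 d0 cK n n0.
pose y := x / n; have -> : x = y * n by rewrite /y divfK ?gt_eqF.
rewrite mulfK ?gt_eqF //.
have S0 : 0 <= \sum_(j < K) expR (b * (d * j%:R) * n) * (- d + d * j%:R <= y)%R%:R.
  by apply: sumr_ge0 => j _; rewrite mulr_ge0 ?expR_ge0.
have E1 := expR_ge0 (- (b * d) * n).
have E2 : 0 <= expR (- c * n) * expR ((b + 1) * (y * n)) by rewrite mulr_ge0 ?expR_ge0.
case: (ltP y (- d)) => yd.
  have : expR (b * (y * n)) <= expR (- (b * d) * n).
    by rewrite ler_expR mulrA ler_pM2r // -mulrN ler_pM2l // ltW.
  lra.
case: (leP c y) => cy.
  have : expR (b * (y * n)) <= expR (- c * n) * expR ((b + 1) * (y * n)).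
    rewrite -expRD ler_expR; nra.
  lra.
pose j := Num.truncn ((y + d) / d).
have yd0 : 0 <= (y + d) / d by rewrite divr_ge0 ?(ltW d0) //; lra.
have /andP[j1 j2] : j%:R <= (y + d) / d < j.+1%:R by rewrite Num.Theory.truncn_itv.
rewrite ler_pdivlMr // in j1; rewrite ltr_pdivrMr // in j2.
have jK : (j < K)%N.
  rewrite -(ltr_nat R) -(ltr_pM2r d0); apply: le_lt_trans j1 _; lra.
rewrite -natr1 in j2.
have : expR (b * (y * n)) <= expR (b * (d * j%:R) * n) * (- d + d * j%:R <= y)%R%:R.
  rewrite (_ : _ <= y) ?mulr1; last lra.
  rewrite ler_expR mulrA ler_pM2r // ler_pM2l //; lra.
have : expR (b * (d * j%:R) * n) * (- d + d * j%:R <= y)%R%:R <=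
  \sum_(j < K) expR (b * (d * j%:R) * n) * (- d + d * j%:R <= y)%R%:R.
  rewrite (bigD1 (Ordinal jK)) //= lerDl; apply: sumr_ge0 => i _.
  by rewrite mulr_ge0 ?expR_ge0.
lra.
Qed.

Section MomentDecay.
Context {R : realType} (P : probability (env R) R) (J : R -> \bar R).
Hypothesis ldp : satisfies_LDP P (@Vbar R) J.

(** The upper half of Varadhan's lemma. Half-lines suffice as test sets because
    the lower bound on J is increasing in y. *)
Lemma moment_decay_rate (b c : R) : 0 < b -> 0 < c ->
  (forall y, ((b * y + c)%:E <= J y)%E) -> (log_moment P (b + 1) < +oo)%E ->
  exp_decay (moment P b).
Proof.
move=> b0 c0 Jbc; rewrite log_momentE.
move=> /lte_real_between[C /andP[/limn_esup_log_lt hC _]].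
(* slices so thin that b * d uses up only half of the margin c / 2 *)
pose d := c / (4 * b).
have d0 : 0 < d by rewrite divr_gt0 ?mulr_gt0.
have bd : b * d = c / 4 by rewrite /d; field; rewrite gt_eqF.
pose K := (Num.truncn ((C + 1) / d + 1)).+1.
have hK : C + 1 <= d * K%:R - d.
  have : (C + 1) / d + 1 < K%:R by exact: Num.Theory.truncnS_gt.
  rewrite -ltrBrDr ltr_pdivrMr // => h; lra.
(* the worst of the three rates: bottom, slices, and top *)
pose e := Num.min (c / 4) 1.
have e0 : 0 < e by rewrite lt_min divr_gt0 ?ltr01.
have ec : e <= c / 4 by rewrite ge_min lexx.
have e1 : e <= 1 by rewrite ge_min lexx orbT.
apply: (@exp_decay_mul _ _ (1 + K%:R + 1) e) => //.
pose y j : R := - d + d * j%:R.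
have up : \forall n \near \oo, forall j, (j < K)%N ->
    (P [set w : env R | y j * n%:R <= log_prod_rho 0 n w]%R
      < (expR (- (b * y j + c / 2) * n%:R))%:E)%E.
  apply: near_forall_lt => j.
  apply: (ldp_upper ldp (b := b * y j + c)); last first.
    by rewrite ltrD2l ltr_pdivrMr // ltr_pMr // ltr1n.
  move=> z yz; apply: le_trans (Jbc z).
  by rewrite lee_fin lerD2r ler_pM2l.
near=> n.
have n0 : 0 < n%:R :> R.
  by rewrite ltr0n; near: n; exact: nbhs_infty_gt.
have upn : forall j, (j < K)%N ->
    (P [set w : env R | y j * n%:R <= log_prod_rho 0 n w]%R
      < (expR (- (b * y j + c / 2) * n%:R))%:E)%E by near: n.
have hCn : (moment P (b + 1) n < (expR (C * n%:R))%:E)%E by near: n.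
pose A j : set (env R) := [set w | y j * n%:R <= log_prod_rho 0 n w].
pose F j w : R := expR (b * (d * j%:R) * n%:R) * \1_(A j) w.
have mA j : measurable (A j) by exact: measurable_high_large.
have mF j : measurable_fun setT (F j) by exact: measurable_funM.
have F0 j w : 0 <= F j w by rewrite mulr_ge0 ?expR_ge0.
pose G w := expR (- (C + 1) * n%:R) * expR ((b + 1) * log_prod_rho 0 n w) : R.
have mG : measurable_fun setT G.
  by apply: measurable_funM => //; exact: measurable_exp_log_prod.
have G0 w : 0 <= G w by rewrite mulr_ge0 ?expR_ge0.
have mS : measurable_fun setT (fun w => \sum_(j < K) F j w) by exact: measurable_sum.
have S0 w : 0 <= \sum_(j < K) F j w by apply: sumr_ge0.
apply: (@le_trans _ _ (mean P
    (fun w => expR (- (b * d) * n%:R) + \sum_(j < K) F j w + G w))).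
  apply: mean_le.
  - exact: measurable_exp_log_prod.
  - by apply: measurable_funD => //; apply: measurable_funD.
  - move=> w; rewrite expR_ge0 /=.
    apply: le_trans (expR_slab_bound (log_prod_rho 0 n w) b0 d0 hK n0) _.
    rewrite lerD2r lerD2l; apply: ler_sum => j _; rewrite /F ler_wpM2l ?expR_ge0 //.
    rewrite indicE ler_nat; case: (boolP (_ <= _ / _)) => //.
    by rewrite ler_pdivlMr // => h; rewrite mem_set.
rewrite meanD //; last 2 first.
- by apply: measurable_funD.
- by move=> w; rewrite addr_ge0 ?expR_ge0.
rewrite meanD // mean_cst (mean_sum P K mF F0).
rewrite meanZ ?expR_ge0 //; last exact: measurable_exp_log_prod.
rewrite !mulrDl !EFinD !mul1r; apply: leeD; first apply: leeD.
- by rewrite lee_fin ler_expR ler_pM2r // lerN2 bd.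
- have -> : (K%:R * expR (- e * n%:R))%:E = (\sum_(j < K) (expR (- e * n%:R))%:E)%E.
    by rewrite sumEFin sumr_const card_ord mulr_natl.
  apply: lee_sum => j _; rewrite /F meanZ ?expR_ge0 // mean_indic //.
  apply: (@le_trans _ _ ((expR (b * (d * j%:R) * n%:R))%:E *
    (expR (- (b * y j + c / 2) * n%:R))%:E)%E).
    by rewrite lee_wpmul2l ?lee_fin ?expR_ge0 // ltW // upn.
  rewrite -EFinM lee_fin -expRD ler_expR -mulrDl ler_pM2r // /y; lra.
- apply: (@le_trans _ _ ((expR (- (C + 1) * n%:R))%:E * (expR (C * n%:R))%:E)%E).
    by rewrite lee_wpmul2l ?lee_fin ?expR_ge0 // ltW.
  rewrite -EFinM lee_fin -expRD ler_expR -mulrDl ler_pM2r //; lra.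
Unshelve. all: by end_near. Qed.

Hypothesis J_ge0 : forall x, (0 <= J x)%E.

Lemma kappa_rate (k : R) : (k%:E < kappa J)%E -> 0 <= k ->
  forall y, ((k * y)%:E <= J y)%E.
Proof.
move=> kk k0 y; case: (ltP 0 y) => y0; last first.
  by apply: le_trans (J_ge0 y); rewrite lee_fin mulr_ge0_le0.
have : (k%:E < J y / y%:E)%E.
  by apply: lt_le_trans kk _; apply: ereal_inf_lbound; exists y.
by rewrite inver gt_eqF // lte_pdivlMr // => /ltW; rewrite EFinM.
Qed.

(** J dominates k y for some k > b by definition of kappa, and l y + e by condA4; the
    convex combination of slope b has a positive constant term. For b <= l the
    decay at l is inherited directly. *)
Lemma moment_decay_below_kappa (b : R) : condA3 P ->
  (exists l : R, 0 < l /\ (log_moment P l < 0)%E) ->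
  0 < b -> (b%:E < kappa J)%E -> exp_decay (moment P b).
Proof.
move=> A3 [l [l0]]; rewrite log_momentE => /limn_esup_log_lt0 hl b0 bk.
case: (leP b l) => bl; first by apply: moment_decay_small hl; rewrite b0.
have [e e0 he] := hl.
have rl := rate_ge ldp l0 he.
have [k /andP[]] := lte_real_between bk; rewrite lte_fin => b_k kk.
have k0 : 0 <= k by rewrite ltW // (lt_trans b0).
have rk := kappa_rate kk k0.
have lk : l < k by exact: lt_trans b_k.
pose t := (k - b) / (k - l).
have t0 : 0 < t by rewrite divr_gt0 // subr_gt0.
have t1 : t <= 1 by rewrite ler_pdivrMr ?subr_gt0 // mul1r lerB // ltW.
have tE : t * (k - l) = k - b by rewrite /t divfK // subr_eq0 gt_eqF.
apply: (@moment_decay_rate _ (t * e)) => //; first by rewrite mulr_gt0.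
move=> y; have := rl y; have := rk y; case: (J y) => [j| |] //; rewrite ?leey //.
rewrite !lee_fin => h1 h2.
have h3 : (1 - t) * (k * y) <= (1 - t) * j by rewrite ler_wpM2l // subr_ge0.
have h4 : t * (l * y + e) <= t * j by rewrite ler_wpM2l // ltW.
have -> : b * y = (k - t * (k - l)) * y by rewrite tE; ring.
lra.
Qed.

Lemma kappa_le1 : condA3 P -> condA4 P -> (kappa J <= 1)%E.
Proof.
move=> A3 [A4 A4']; rewrite leNgt; apply/negP => k1.
have := exp_decay_limn_esup (moment_decay_below_kappa A3 A4' ltr01 k1).
by rewrite -log_momentE ltNge A4.
Qed.

Lemma moment_summable (b : R) : (forall n, (moment P b n < +oo)%E) ->
  exp_decay (moment P b) ->
  exists2 C : R, 0 <= C & forall L, (\sum_(j < L) moment P b j <= C%:E)%E.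
Proof.
move=> fin [e e0 [N _ hN]].
have m0 j : (0 <= moment P b j)%E by apply: mean_ge0 => w; exact: expR_ge0.
pose r j := fine (moment P b j).
have rE j : moment P b j = (r j)%:E by rewrite fineK // ge0_fin_numE.
have r0 j : 0 <= r j by rewrite fine_ge0.
pose q := expR (- e); have q0 : 0 < q by exact: expR_gt0.
have q1 : q < 1 by rewrite -expR0 ltr_expR oppr_lt0.
(* the terms before N are absorbed into the constant of the geometric bound *)
pose D := 1 + \sum_(j < N) r j / q ^+ j.
have D1 : 1 <= D.
  by rewrite lerDl sumr_ge0 // => j _; rewrite divr_ge0 ?exprn_ge0 ?(ltW q0).
have D0 : 0 <= D by rewrite (le_trans ler01).
have rD j : r j <= D * q ^+ j.
  case: (ltnP j N) => jN.
    rewrite -ler_pdivrMr ?exprn_gt0 // /D (bigD1 (Ordinal jN)) //=.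
    rewrite addrCA lerDl addr_ge0 // sumr_ge0 // => i _.
    by rewrite divr_ge0 ?exprn_ge0 ?(ltW q0).
  have := hN j jN; rewrite rE lee_fin expRM_natr => h.
  by apply: le_trans h _; rewrite ler_peMl // exprn_ge0 // ltW.
exists (D / (1 - q)); first by rewrite divr_ge0 // subr_ge0 ltW.
move=> L; under eq_bigr do rewrite rE; rewrite sumEFin lee_fin.
apply: (@le_trans _ _ (\sum_(j < L) D * q ^+ j)); first by apply: ler_sum.
rewrite -mulr_sumr ler_wpM2l //.
rewrite -[leRHS]mul1r ler_pdivlMr ?subr_gt0 //.
have := subrX1 q L => h.
have : 0 <= q ^+ L by rewrite exprn_ge0 // ltW.
have -> : (\sum_(i < L) q ^+ i) * (1 - q) = 1 - q ^+ L.
  by apply: oppr_inj; rewrite opprB h; ring.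
lra.
Qed.

End MomentDecay.

(** * Hitting times are not too large *)
Section SlowdownUpperBound.
Context {R : realType}.

(** With t = x / (x + y), both t <= t^b and 1 - t <= (1 - t)^b. *)
Lemma powR_subadditive (x y b : R) : 0 <= x -> 0 <= y -> 0 < b <= 1 ->
  (x + y) `^ b <= x `^ b + y `^ b.
Proof.
move=> x0 y0 /andP[b0 b1]; case: (ltP 0 (x + y)) => xy; last first.
  have -> : x + y = 0 by lra.
  by rewrite powR0 ?gt_eqF // addr_ge0 ?powR_ge0.
have part z : 0 <= z -> z <= x + y -> (x + y) `^ b * (z / (x + y)) <= z `^ b.
  move=> z0 zxy; have [->|zn0] := eqVneq z 0.
    by rewrite mul0r mulr0 powR_ge0.
  have zE : z = (x + y) * (z / (x + y)) by rewrite mulrC divfK // gt_eqF.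
  have t0 : 0 < z / (x + y) by rewrite divr_gt0 // lt_def zn0.
  have t1 : z / (x + y) <= 1 by rewrite ler_pdivrMr // mul1r.
  rewrite [in leRHS]zE powRM ?(ltW xy) ?(ltW t0) // ler_wpM2l ?powR_ge0 //.
  by rewrite ger1_powR // t0.
have px : (x + y) `^ b * (x / (x + y)) <= x `^ b by apply: part => //; lra.
have py : (x + y) `^ b * (y / (x + y)) <= y `^ b by apply: part => //; lra.
apply: le_trans (lerD px py); rewrite -mulrDr -mulrDl divff ?gt_eqF //.
by rewrite mulr1.
Qed.

Lemma powR_sum_le (I : Type) (s : seq I) (f : I -> R) (b : R) :
  (forall i, 0 <= f i) -> 0 < b <= 1 ->
  (\sum_(i <- s) f i) `^ b <= \sum_(i <- s) f i `^ b.
Proof.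
move=> f0 hb; elim: s => [|i s IH].
  by rewrite !big_nil powR0 // gt_eqF //; case/andP: hb.
rewrite !big_cons; apply: le_trans (powR_subadditive (f0 i) _ hb) _.
  by apply: sumr_ge0.
by rewrite lerD2l.
Qed.

Lemma prod_odds_backward (w : env R) (k : int) (j : nat) :
  \prod_(l < j) odds (omega w) (k - l%:Z) =
  expR (log_prod_rho (k + 1 - j%:Z) j w).
Proof.
rewrite expR_log_prod_rho (reindex_inj rev_ord_inj); apply: eq_bigr => l _ /=.
rewrite -[odds _ _]/(rho _ w); congr (rho _ w).
rewrite -subzn ?ltn_ord // -[l.+1]addn1 PoszD; ring.
Qed.

(** The Markov inequality in the form s <= s^b <= (E min(T_n, N+1) / (N+1))^b,
    where s <= 1 and b <= 1 allow the first step. *)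
Lemma survival_powR (w : env R) (n N : nat) (b : R) : 0 < b <= 1 ->
  survival (omega w) n%:Z N 0 <= N.+1%:R `^ (- b) *
   \sum_(k < n) \sum_(j < N.+1)
     (expR (b * log_prod_rho (k%:Z + 1 - j%:Z) j w) +
      expR (b * log_prod_rho (k%:Z + 1 - j.+1%:Z) j.+1 w)).
Proof.
move=> hb; have /andP[b0 b1] := hb.
have p01 := omega_itv w.
set s := survival _ _ _ _.
have /andP[s0 s1] : 0 <= s <= 1 by exact: survival_itv.
pose U := \sum_(k < n) step_time (omega w) N.+1 k%:Z.
have U0 : 0 <= U by apply: sumr_ge0 => k _; exact: step_time_ge0.
have N0 : 0 < N.+1%:R :> R by rewrite ltr0n.
have sU : s <= N.+1%:R^-1 * U.
  rewrite -(ler_pM2l N0) mulrA divff ?gt_eqF // mul1r.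
  apply: le_trans (survival_le_total _ p01 _ _) _.
  apply: le_trans (total_survival p01 _ (add0r n%:Z)) _.
  by rewrite /U; apply: ler_sum => k _; rewrite add0r.
apply: (@le_trans _ _ (s `^ b)).
  have [->|sn0] := eqVneq s 0; first exact: powR_ge0.
  by apply: ger1_powR => //; rewrite lt_def sn0 s0.
apply: (@le_trans _ _ ((N.+1%:R^-1 * U) `^ b)).
  apply: ge0_ler_powR sU; rewrite ?nnegrE ?(ltW b0) //.
  by rewrite mulr_ge0 // invr_ge0 ltW.
rewrite powRM ?invr_ge0 ?(ltW N0) // -powR_inv1 ?(ltW N0) // -powRrM mulN1r.
rewrite ler_wpM2l ?powR_ge0 // /U.
apply: le_trans (powR_sum_le _ _ hb) _; first by move=> k; exact: step_time_ge0.
apply: ler_sum => k _; rewrite step_timeE.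
have e0 j : 0 <= \prod_(l < j) odds (omega w) (k%:Z - l%:Z).
  by rewrite prod_odds_backward expR_ge0.
apply: le_trans (powR_sum_le _ _ hb) _; first by move=> j; rewrite addr_ge0.
apply: ler_sum => j _.
apply: le_trans (powR_subadditive (e0 _) (e0 _) hb) _.
by rewrite !prod_odds_backward /powR !gt_eqF ?expR_gt0 // !expRK.
Qed.

Lemma mean_survival_le (P : probability (env R) R) (b C : R) :
  stationary P -> 0 < b <= 1 ->
  (forall L, (\sum_(j < L) moment P b j <= C%:E)%E) ->
  forall n N : nat, (mean P (fun w => survival (omega w) n%:Z N 0%Z)
    <= (N.+1%:R `^ (- b) * (n%:R * (C + C)))%:E)%E.
Proof.
move=> P_stat hb hC n N.
have mE a j : measurable_fun setT (fun w : env R => expR (b * log_prod_rho a j w)).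
  exact: measurable_exp_log_prod.
pose F (k j : nat) w : R := expR (b * log_prod_rho (k%:Z + 1 - j%:Z) j w) +
      expR (b * log_prod_rho (k%:Z + 1 - j.+1%:Z) j.+1 w).
have mF k j : measurable_fun setT (F k j) by apply: measurable_funD.
have F0 k j w : 0 <= F k j w by rewrite addr_ge0 ?expR_ge0.
have mS k : measurable_fun setT (fun w => \sum_(j < N.+1) F k j w).
  by apply: measurable_sum.
have S0 k w : 0 <= \sum_(j < N.+1) F k j w by apply: sumr_ge0.
apply: (@le_trans _ _ (mean P (fun w => N.+1%:R `^ (- b) *
   \sum_(k < n) \sum_(j < N.+1) F k j w))).
  apply: mean_le; first exact: measurable_survival.
    by apply: measurable_funM => //; apply: measurable_sum.
  move=> w; rewrite survival_powR // andbT.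
  by have /andP[] := survival_itv n (omega_itv w) N 0.
rewrite meanZ ?powR_ge0 //; last 2 first.
- by apply: measurable_sum.
- by move=> w; apply: sumr_ge0.
rewrite EFinM lee_wpmul2l ?lee_fin ?powR_ge0 //.
rewrite (mean_sum P n mS S0).
have -> : (n%:R * (C + C))%:E = (\sum_(k < n) (C + C)%:E)%E.
  by rewrite sumEFin sumr_const card_ord mulr_natl.
apply: lee_sum => k _; rewrite (mean_sum P N.+1 (mF k) (F0 k)).
under eq_bigr do rewrite /F meanD ?expR_ge0 // !moment_translate //.
rewrite big_split /= EFinD; apply: leeD; first exact: hC.
apply: le_trans (hC N.+2); rewrite [leRHS]big_ord_recl /=.
by apply: leeDr; apply: mean_ge0 => w; exact: expR_ge0.
Qed.

End SlowdownUpperBound.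

(** * Barriers *)
Section HighBlocks.
Context {R : realType} (P : probability (env R) R).

Definition coord_generators (I : set int) : set (set (env R)) :=
  \bigcup_(i in I) preimage_set_system setT (fun w : env R => omega w i) measurable.

Lemma coord_generators_omega (I : set int) i : I i ->
  measurable_fun setT
    (fun w : g_sigma_algebraType (coord_generators I) => omega (w : env R) i).
Proof.
move=> Ii _ B mB; apply: sub_sigma_algebra; exists i => //.
by exists B.
Qed.

(** The first site a ranges over all integers so that stationarity can slide the
    blocks to either side of the origin. *)
Definition low_blocks (c : R) (m G : nat) (a : int) (k : nat) : set (env R) :=
  [set w | forall j, (j < k)%N -> log_prod_rho (a + (j * G)%:Z) m w <= c].

Lemma low_blocksS c m G a k : low_blocks c m G a k.+1 =
  low_blocks c m G a k `&` low_blocks c m G (a + (k * G)%:Z) 1.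
Proof.
apply/seteqP; split => w /=.
  move=> h; split => [j jk|j]; first by apply: h; rewrite ltnW.
  by rewrite ltnS leqn0 => /eqP ->; rewrite mul0n addr0; exact: h.
move=> [h1 h2] j; rewrite ltnS leq_eqVlt => /orP[/eqP ->|]; last exact: h1.
by have := h2 0%N isT; rewrite mul0n addr0.
Qed.

Lemma sigma_coord_low_blocks (I : set int) c m G a k :
  (forall j i, (j < k)%N -> (i < m)%N -> I (a + (j * G)%:Z + i%:Z)) ->
  sigma_coord I (low_blocks c m G a k).
Proof.
move=> hI.
pose T := g_sigma_algebraType (coord_generators I).
suff : measurable (low_blocks c m G a k : set T) by [].
have -> : low_blocks c m G a k = \bigcap_(j in [set j | (j < k)%N])
    [set w : T | log_prod_rho (a + (j * G)%:Z) m (w : env R) <= c].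
  by apply/seteqP; split.
have [->|k0] := posnP k.
  by rewrite (_ : [set j | _] = set0) ?bigcap_set0 //; apply/seteqP; split.
apply: bigcap_measurable; first by exists 0%N.
move=> j /= jk; rewrite -[X in measurable X]setTI.
have mf := @measurable_log_prod_rho R _ T id (a + (j * G)%:Z) m
  (fun i im => coord_generators_omega (hI j i jk im)).
have := mf measurableT `]-oo, c]%classic (measurable_itv _).
by congr (measurable (_ `&` _)); apply/seteqP; split => w /=; rewrite in_itv.
Qed.

Lemma measurable_low_blocks c m G a k : measurable (low_blocks c m G a k).
Proof.
have -> : low_blocks c m G a k = \bigcap_(j in [set j | (j < k)%N])
    ~` [set w : env R | c < log_prod_rho (a + (j * G)%:Z) m w].
  apply/seteqP; split => w /= h j jk; first by apply/negP; rewrite -leNgt; exact: h.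
  by have := h j jk => /= /negP; rewrite -leNgt.
have [->|k0] := posnP k.
  by rewrite (_ : [set j | _] = set0) ?bigcap_set0 //; apply/seteqP; split.
apply: bigcap_measurable; first by exists 0%N.
by move=> j _; apply: measurableC; exact: measurable_high.
Qed.

Hypothesis P_stationary : stationary P.

Lemma low_blocks_translate c m G a z k :
  P (low_blocks c m G (a + z) k) = P (low_blocks c m G a k).
Proof.
rewrite -[RHS](translate_invariant P_stationary z); last exact: measurable_low_blocks.
congr (P _); apply/seteqP; split => w /= h j jk.
  by rewrite /preimage /= log_prod_rho_translate addrAC; exact: h.
by have := h j jk; rewrite log_prod_rho_translate addrAC.
Qed.

Lemma fine_prob_itv (A : set (env R)) : measurable A -> 0 <= fine (P A) <= 1.
Proof.
move=> mA; rewrite fine_ge0 //= -lee_fin fineK ?fin_num_measure //.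
exact: probability_le1.
Qed.

Lemma sigma_coord_measurable (I : set int) (A : set (env R)) :
  sigma_coord I A -> measurable A.
Proof.
apply: smallest_sub; first exact: sigma_algebra_measurable.
by move=> _ [i _ [B mB <-]]; exact: measurable_omega.
Qed.

Lemma mixing_bound (n : nat) (A B : set (env R)) :
  sigma_coord [set i | i <= 0] A -> sigma_coord [set i | n%:Z <= i] B ->
  fine (P (A `&` B)) <= fine (P A) * fine (P B) + mixing P n.
Proof.
move=> hA hB; rewrite -lerBlDl; apply: le_trans (ler_norm _) _.
apply: ub_le_sup; last by exists A, B.
exists 1 => _ [A' [B' [/sigma_coord_measurable mA /sigma_coord_measurable mB ->]]].
have /andP[a0 a1] := fine_prob_itv mA; have /andP[b0 b1] := fine_prob_itv mB.
have /andP[c0 c1] := fine_prob_itv (measurableI _ _ mA mB).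
rewrite ler_norml; nra.
Qed.

Lemma mixing_ge0 n : 0 <= mixing P n.
Proof.
have sT I : sigma_coord I (setT : set (env R)).
  have := @measurableT _ (g_sigma_algebraType (coord_generators I)); exact.
have := mixing_bound (sT [set i | i <= 0]) (sT [set i | n%:Z <= i]).
by rewrite setIT probability_setT mulr1 lerDl.
Qed.

(** By stationarity the blocks may be moved so that the last one starts at g and
    the others end before 0, which is the position in which the mixing coefficient
    compares them. *)
Lemma low_blocks_rec c m g k (q := fun k => fine (P (low_blocks c m (m + g) 1 k))) :
  q k.+1 <= q k * q 1%N + mixing P g.
Proof.
pose a : int := g%:Z - (k * (m + g))%:Z.
have tr j z : q j = fine (P (low_blocks c m (m + g) z j)).
  by rewrite /q -(low_blocks_translate _ _ _ 1 (z - 1)) addrCA subrr addr0.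
rewrite (tr k.+1 a) (tr k a) (tr 1%N (a + (k * (m + g))%:Z)) low_blocksS.
apply: mixing_bound; apply: sigma_coord_low_blocks => j i jk im /=.
  by have := leq_mul2r (m + g) j.+1 k; rewrite jk orbT mulSn /a; lia.
by move: jk; rewrite ltnS leqn0 => /eqP ->; rewrite mul0n /a; lia.
Qed.

(** Solving q_{k+1} <= q_k (1 - p) + eta gives q_k <= (1 - p)^k + eta / p, and
    (1 - p)^k <= 1 / (1 + k p). *)
Lemma low_blocks_bound c m g k
    (p := fine (P [set w : env R | c < log_prod_rho 0 m w])) : 0 < p ->
  fine (P (low_blocks c m (m + g) 1 k)) <= (1 + k%:R * p)^-1 + mixing P g / p.
Proof.
move=> p0; have /andP[_ p1] : 0 <= p <= 1.
  by apply: fine_prob_itv; exact: measurable_high.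
have q1 : fine (P (low_blocks c m (m + g) 1 1)) = 1 - p.
  rewrite -(low_blocks_translate _ _ _ _ (- 1)) subrr.
  have -> : low_blocks c m (m + g) 0 1 =
      ~` [set w : env R | c < log_prod_rho 0 m w].
    apply/seteqP; split => w /=.
      move=> /(_ 0%N isT); rewrite mul0n addr0 => h.
      by apply/negP; rewrite -leNgt.
    move=> /negP; rewrite -leNgt => h j.
    by rewrite ltnS leqn0 => /eqP ->; rewrite mul0n addr0.
  have mh := measurable_high (R := R) c 0 m.
  have := probability_setC P mh => ->.
  by rewrite fineB ?fin_num_measure.
have e0 := mixing_ge0 g.
have ep : 0 <= mixing P g / p by rewrite divr_ge0 // ltW.
elim: k => [|k IH].
  rewrite mul0r addr0 invr1; apply: ler_wpDr => //.
  by have /andP[] := fine_prob_itv (measurable_low_blocks c m (m + g) 1 0).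
apply: le_trans (low_blocks_rec _ _ _ _) _; rewrite q1.
have h1 : fine (P (low_blocks c m (m + g) 1 k)) * (1 - p) <=
    ((1 + k%:R * p)^-1 + mixing P g / p) * (1 - p).
  by rewrite ler_wpM2r // subr_ge0.
have kp : 0 <= k%:R * p by rewrite mulr_ge0 // ltW.
have h2 : (1 + k%:R * p)^-1 * (1 - p) <= (1 + k.+1%:R * p)^-1.
  rewrite -natr1 mulrC ler_pdivrMr; last by lra.
  rewrite ler_pdivlMl; last by lra.
  nra.
have h3 : mixing P g / p * (1 - p) = mixing P g / p - mixing P g.
  by field; rewrite gt_eqF.
lra.
Qed.

(** To reach n the walk must first pass the start of the barrier and then cross it. *)
Lemma crossing_time_small c m g k (n N : nat) (w : env R) :
  (0 < g)%N -> (k * (m + g) <= n)%N -> ~ low_blocks c m (m + g) 1 k w ->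
  1 - survival (omega w) n%:Z N 0 <= N%:R * expR (- c).
Proof.
move=> g0 kn; rewrite /low_blocks /= => /existsNP[j /not_implyP[jk /negP]].
rewrite -ltNge => hj.
have jn := leq_mul2r (m + g) j.+1 k; rewrite jk orbT mulSn in jn.
have := @crossing_bound _ _ n%:Z (omega_itv w) N (j * (m + g))%:Z m (expR c)
  _ (expR_gt0 _).
rewrite expRN; have := survival_decr_nat n%:Z (omega_itv w) N 0 (j * (m + g)).
rewrite add0r => h1 h2; apply: (le_trans _ (h2 _ _)).
- by rewrite lerB.
- lia.
- rewrite addrC -[X in _ <= X]/(\prod_(l < m) rho (1 + (j * (m + g))%:Z + l%:Z) w).
  by rewrite -expR_log_prod_rho ler_expR ltW.
Qed.

Lemma mean_crossed_le c m g k (n N : nat) : (0 < g)%N -> (k * (m + g) <= n)%N ->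
  (mean P (fun w => 1 - survival (omega w) n%:Z N 0)%R <=
    (fine (P (low_blocks c m (m + g) 1 k)) + N%:R * expR (- c))%:E)%E.
Proof.
move=> g0 kn; pose F := low_blocks c m (m + g) 1 k.
have mF : measurable F by exact: measurable_low_blocks.
have Nc : 0 <= N%:R * expR (- c) :> R by rewrite mulr_ge0 ?expR_ge0.
rewrite EFinD fineK ?fin_num_measure //.
rewrite -(mean_indic P mF) -(mean_cst P (N%:R * expR (- c))).
rewrite -meanD //.
apply: mean_le.
- by apply: measurable_funB => //; exact: measurable_survival.
- by apply: measurable_funD.
- move=> w; have /andP[s0 s1] := survival_itv n%:Z (omega_itv w) N 0.
  rewrite subr_ge0 s1 /= indicE; have [_|wF] := boolP (w \in F).
    by apply: lerD => //; rewrite (le_trans _ Nc) // oppr_le0.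
  rewrite add0r; apply: (crossing_time_small _ g0 kn) => /mem_set.
  by rewrite (negbTE wF).
Qed.

End HighBlocks.

(** * Hitting times are not too small *)
Section SlowdownLowerBound.
Context {R : realType}.

Lemma powRN_cvg0 (e : R) : 0 < e -> (n%:R `^ (- e) : R) @[n --> \oo] --> 0.
Proof.
move=> e0; apply/cvgrPdist_lt => d d0; near=> n.
have n0 : 0 < n%:R :> R by rewrite ltr0n; near: n; exact: nbhs_infty_gt.
rewrite sub0r normrN ger0_norm ?powR_ge0 // powRN -[d]invrK.
rewrite ltf_pV2 ?posrE ?invr_gt0 ?powR_gt0 //.
have -> : d^-1 = (d^-1 `^ e^-1) `^ e.
  by rewrite -powRrM mulVf ?gt_eqF // powRr1 // invr_ge0 ltW.
apply: gt0_ltr_powR => //; rewrite ?nnegrE ?powR_ge0 ?(ltW n0) //.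
by near: n; exact: nbhs_infty_gtr.
Unshelve. all: by end_near. Qed.

Variables (P : probability (env R) R) (J : R -> \bar R).

Lemma mixing_rate (xi : R) : condA1 P -> 0 < xi ->
  \forall n \near \oo, n%:R `^ xi * mixing P n <= 2.
Proof.
move=> A1 xi0; have /cvgrPdist_lt/(_ 1 ltr01)[N _ hN] := A1 xi xi0.
exists (maxn N 1) => // n /=; rewrite geq_max => /andP[Nn n1].
have := hN n Nn; have := hN n.+1 (leqW Nn) => /=.
rewrite big_nat_recr //= !ltr_norml => /andP[? ?] /andP[? ?]; lra.
Qed.

Hypothesis P_stationary : stationary P.
Hypothesis ldp : satisfies_LDP P (@Vbar R) J.
Hypothesis J_ge0 : forall x, (0 <= J x)%E.

(** Blocks of m = log n / th sites with gaps n^d: their number is about n^(1 - d)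
    and each is a barrier with probability p of order n^(- b / th) = n^(2d - 1).
    Hence the expected number of barriers is about n^d, while polynomial mixing of
    order 1/d makes the error eta / p at most of order n^(- 2d). *)
Lemma crossed_mean_bound (b y th : R) : condA1 P -> 0 < b -> 0 < th -> b < th ->
  0 < y ->
  (\forall m \near \oo, ((expR (- b * m%:R))%:E
     <= P [set w : env R | y * m%:R < log_prod_rho 0 m w]%R)%E) ->
  let d := (1 - b / th) / 2 in
  exists K : R, \forall n \near \oo, forall N : nat,
    (mean P (fun w => 1 - survival (omega w) n%:Z N 0)%R <=
      (K * n%:R `^ (- d) + N%:R * n%:R `^ (- (y / th)))%:E)%E.
Proof.
move=> A1 b0 th0 bth y0 [m0 _ hm] d.
have d0 : 0 < d by rewrite divr_gt0 // subr_gt0 ltr_pdivrMr // mul1r.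
have bE : b / th = 1 - 2 * d by rewrite /d; field; rewrite gt_eqF.
have xi0 : 0 < d^-1 by rewrite invr_gt0.
have [g0 _ hg] := mixing_rate A1 xi0.
(* m + g <= (log n / th + 1) + (n^d + 1), with log n <= n^d / d and 1 <= n^d *)
pose K1 : R := (d * th)^-1 + 3.
exists ((K1 + 2) * expR b); near=> n => N.
have n1 : 1 <= n%:R :> R by near: n; exact: nbhs_infty_ger.
have n_m0 : expR (m0%:R * th) <= n%:R by near: n; exact: nbhs_infty_ger.
have n_g0 : g0%:R `^ d^-1 <= n%:R :> R by near: n; exact: nbhs_infty_ger.
pose x : R := n%:R; pose L := ln x.
have x0 : 0 < x by exact: lt_le_trans ltr01 n1.
have xE : x = expR L by rewrite lnK.
have L0 : 0 <= L by rewrite ln_ge0.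
pose X := x `^ d.
have XE : X = expR (d * L) by rewrite /X /powR gt_eqF.
have X0 : 0 < X by rewrite powR_gt0.
have X1 : 1 <= X by rewrite XE -expR0 ler_expR mulr_ge0 // ltW.
have LX : d * L <= X by rewrite XE; apply: le_trans (expR_ge1Dx _); rewrite lerDr.
pose m := (Num.truncn (L / th)).+1.
have Lth0 : 0 <= L / th by rewrite divr_ge0 // ltW.
have m_lo : L / th <= m%:R by apply: ltW; exact: Num.Theory.truncnS_gt.
have m_hi : m%:R <= L / th + 1.
  by rewrite /m -natr1 lerD2r; have /andP[] := Num.Theory.truncn_itv Lth0.
pose g := (Num.truncn X).+1.
have g_lo : X <= g%:R by apply: ltW; exact: Num.Theory.truncnS_gt.
have g_hi : g%:R <= X + 1.
  by rewrite /g -natr1 lerD2r; have /andP[] := Num.Theory.truncn_itv (ltW X0).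
pose G := (m + g)%N; pose k := (n %/ G)%N.
have G0 : (0 < G)%N by rewrite addn_gt0.
have kn : (k * G <= n)%N by exact: leq_trunc_div.
have nk : x <= (k%:R + 1) * G%:R.
  by rewrite natr1 -natrM ler_nat ltnW // ltn_ceil.
have G_hi : G%:R <= K1 * X.
  rewrite natrD /K1.
  have : L / th <= (d * th)^-1 * X.
    have -> : (d * th)^-1 * X = X / d / th by field; rewrite !gt_eqF.
    by rewrite ler_pM2r ?invr_gt0 // ler_pdivlMr // mulrC.
  lra.
have mm0 : (m0 <= m)%N.
  by rewrite -(ler_nat R) (le_trans _ m_lo) // ler_pdivlMr // -ler_expR -xE.
have gg0 : (g0 <= g)%N.
  rewrite -(ler_nat R) (le_trans _ g_lo) //.
  have -> : g0%:R = (g0%:R `^ d^-1) `^ d :> R.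
    by rewrite -powRrM mulVf ?gt_eqF // powRr1.
  by apply: ge0_ler_powR; rewrite ?nnegrE ?powR_ge0 ?(ltW x0) ?(ltW d0).
pose c := y * m%:R.
pose A : set (env R) := [set w | c < log_prod_rho 0 m w].
have mA : measurable A by exact: measurable_high.
pose p := fine (P A).
have /andP[_ p1] : 0 <= p <= 1 by exact: fine_prob_itv.
(* q is exp(-b (log n / th + 1)), a lower bound for p *)
pose q := expR (- b) * X ^+ 2 / x.
have q0 : 0 < q by rewrite divr_gt0 // mulr_gt0 ?expR_gt0 ?exprn_gt0.
have qp : q <= p.
  rewrite -lee_fin fineK ?fin_num_measure //; apply: le_trans (hm m mm0).
  rewrite lee_fin /q xE -expRN XE -expRM_natr -!expRD ler_expR.
  have : b * m%:R <= b * (L / th + 1) by rewrite ler_pM2l.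
  have -> : b * (L / th + 1) = b / th * L + b by ring.
  rewrite bE; lra.
have p0 : 0 < p by exact: lt_le_trans qp.
have xq : x * q = expR (- b) * X ^+ 2 by rewrite /q mulrC divfK // gt_eqF.
have eb : expR (- b) * expR b = 1 by rewrite -expRD addNr expR0.
have first : (1 + k%:R * p)^-1 <= K1 * expR b / X.
  have h1 : x * q <= (1 + k%:R * p) * (K1 * X).
    apply: (@le_trans _ _ ((k%:R + 1) * G%:R * q)).
      by rewrite ler_wpM2r // ltW.
    rewrite mulrAC; apply: ler_pM => //.
    - by rewrite mulr_ge0 ?(ltW q0) // addr_ge0.
    - rewrite mulrDl mul1r addrC lerD ?(le_trans qp) // ler_wpM2l //.
  have kp0 : 0 < 1 + k%:R * p by rewrite ltr_pwDl // mulr_ge0 // ltW.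
  rewrite -[leLHS]mul1r ler_pdivrMr // mulrC mulrA ler_pdivlMr // mul1r.
  rewrite xq expr2 mulrA mulrA ler_pM2r // in h1.
  have := ler_wpM2l (expR_ge0 b) h1.
  by rewrite mulrA [expR b * _]mulrC eb mul1r; lra.
have second : mixing P g / p <= 2 * expR b / X.
  (* g >= n^d and the mixing exponent 1/d turn the mixing rate into 2 / n *)
  have h2 : x * mixing P g <= 2.
    apply: le_trans (hg g gg0); rewrite ler_wpM2r ?mixing_ge0 //.
    have -> : x = X `^ d^-1 by rewrite /X -powRrM mulfV ?gt_eqF // powRr1 // ltW.
    by apply: ge0_ler_powR; rewrite ?nnegrE ?(ltW X0) ?invr_ge0 ?(ltW d0).
  rewrite ler_pdivrMr // -(ler_pM2l x0); apply: le_trans h2 _.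
  apply: (@le_trans _ _ (2 * expR b / X * (x * q))).
    rewrite xq; have -> : 2 * expR b / X * (expR (- b) * X ^+ 2) =
       2 * (expR (- b) * expR b) * X by field; rewrite gt_eqF.
    by rewrite eb mulr1 ler_pMr.
  rewrite [leRHS]mulrCA ler_wpM2l //.
    by rewrite divr_ge0 ?mulr_ge0 ?expR_ge0 // ltW.
  by rewrite ler_pM2l.
apply: le_trans (mean_crossed_le P c N (ltn0Sn _ : (0 < g)%N) kn) _.
rewrite lee_fin; apply: lerD.
  apply: le_trans (low_blocks_bound P_stationary _ _ p0) _.
  rewrite powRN -/x -/X mulrDl mulrDl; exact: lerD.
rewrite ler_wpM2l // /powR gt_eqF // ler_expR -/x -/L /c.
have : y * (L / th) <= y * m%:R by rewrite ler_pM2l.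
have -> : - (y / th) * L = - (y * (L / th)) by ring.
lra.
Unshelve. all: by end_near. Qed.

(** Since J(y) < alpha y there is room for b and th with
    J(y) < b < th < alpha y', where y' is slightly smaller than y because the
    lower large-deviation bound needs an open set around y. *)
Lemma crossed_mean_cvg0 (alpha M : R) : condA1 P -> 0 < alpha ->
  (kappa J < alpha%:E)%E -> 0 <= M ->
  mean P (fun w => 1 - survival (omega w) n%:Z (Num.truncn (M * n%:R `^ alpha^-1)) 0)%R
    @[n --> \oo] --> 0%E.
Proof.
move=> A1 al0 /ereal_inf_lt[_ [y /= y0 <-]].
rewrite inver gt_eqF // lte_pdivrMr // => Jy M0.
have [b /andP[Jb]] := lte_real_between Jy; rewrite -EFinM lte_fin => bal.
have b0 : 0 < b by rewrite -lte_fin; exact: le_lt_trans Jb.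
(* alpha * (y - dy) is then the midpoint of b and alpha * y *)
pose dy := (alpha * y - b) / (2 * alpha).
have dy0 : 0 < dy by rewrite divr_gt0 ?mulr_gt0 ?subr_gt0.
pose y' := y - dy.
have aly' : alpha * y' = (alpha * y + b) / 2.
  by rewrite /y' /dy; field; rewrite gt_eqF.
have bal' : b < alpha * y' by rewrite aly'; lra.
have y'0 : 0 < y' by rewrite -(pmulr_rgt0 _ al0) (lt_trans b0).
pose th := (b + alpha * y') / 2.
have bth : b < th by rewrite /th; lra.
have thal : th < alpha * y' by rewrite /th; lra.
have th0 : 0 < th by exact: lt_trans bth.
have lo : \forall m \near \oo, ((expR (- b * m%:R))%:E
     <= P [set w : env R | y' * m%:R < log_prod_rho 0 m w]%R)%E.
  by apply: filterS (ldp_lower ldp Jb dy0) => m /ltW.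
have [K hK] := crossed_mean_bound A1 b0 th0 bth y'0 lo.
set d := (1 - b / th) / 2 in hK.
have d0 : 0 < d by rewrite divr_gt0 // subr_gt0 ltr_pdivrMr // mul1r.
pose e := y' / th - alpha^-1.
have e0 : 0 < e.
  by rewrite subr_gt0 ltr_pdivlMr // mulrC ltr_pdivrMr // mulrC.
pose B n : R := K * n%:R `^ (- d) + M * n%:R `^ (- e).
have B0 : B n @[n --> \oo] --> 0.
  rewrite -[X in _ --> X](addr0 0); apply: cvgD.
    by rewrite -[X in _ --> X](mulr0 K); apply: cvgMr; exact: powRN_cvg0.
  by rewrite -[X in _ --> X](mulr0 M); apply: cvgMr; exact: powRN_cvg0.
apply: (squeeze_cvge (f := fun=> 0%E) (h := EFin \o B)).
- near=> n; apply/andP; split.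
    apply: mean_ge0 => w; rewrite subr_ge0.
    by have /andP[] := survival_itv n%:Z (omega_itv w)
      (Num.truncn (M * n%:R `^ alpha^-1)) 0.
  have hn : forall N : nat,
    (mean P (fun w => 1 - survival (omega w) n%:Z N 0)%R <=
      (K * n%:R `^ (- d) + N%:R * n%:R `^ (- (y' / th)))%:E)%E by near: n.
  apply: le_trans (hn _) _; rewrite lee_fin lerD2l.
  have n0 : n%:R != 0 :> R.
    by rewrite pnatr_eq0 -lt0n; near: n; exact: nbhs_infty_gt.
  have -> : - e = alpha^-1 - y' / th by rewrite /e opprB.
  rewrite powRD ?n0 ?implybT // mulrA ler_wpM2r ?powR_ge0 //.
  by have /andP[] := Num.Theory.truncn_itv (mulr_ge0 M0 (powR_ge0 n%:R alpha^-1)).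
- exact: cvg_cst.
- apply: cvg_EFin; [exact: nearW|exact: B0].
Unshelve. all: by end_near. Qed.

End SlowdownLowerBound.

(** * Annealed hitting times *)
Section HittingTime.
Context {R : realType}.

Lemma hitting_time_ge0 n x : (0 <= hitting_time R n x)%E.
Proof. by apply: le_ereal_inf_tmp => _ [i _ <-]; rewrite lee_fin. Qed.

Lemma hitting_time_gt n (t : R) x : 0 <= t ->
  (t%:E < hitting_time R n x)%E <-> avoid n%:Z (Num.truncn t) x.
Proof.
move=> t0; have /andP[t1 t2] := Num.Theory.truncn_itv t0; split.
  move=> tT i it xi.
  have : (hitting_time R n x <= i%:R%:E)%E by apply: ereal_inf_lbound; exists i.
  move=> /(lt_le_trans tT); rewrite lte_fin ltNge => /negP; apply.
  by apply: le_trans t1; rewrite ler_nat.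
move=> h; apply: (@lt_le_trans _ _ (Num.truncn t).+1%:R%:E); first by rewrite lte_fin.
apply: le_ereal_inf_tmp => _ [i /= xi <-]; rewrite lee_fin ler_nat ltnNge.
by apply/negP => /h.
Qed.

Lemma scaled_hitting_time_gt n (s t : R) x : 0 < s -> 0 <= t ->
  (t%:E < s^-1%:E * hitting_time R n x)%E <-> avoid n%:Z (Num.truncn (t * s)) x.
Proof.
move=> s0 t0; rewrite lte_pdivlMl // mulrC -EFinM.
by apply: hitting_time_gt; rewrite mulr_ge0 // ltW.
Qed.

End HittingTime.

Section AnnealedLaw.
Context {R : realType} (P : probability (env R) R).
Variable Pquenched : env R -> probability walk_path R.
Variable PP : probability (env R * walk_path)%type R.
Hypothesis Pquenched_law : forall w : env R, quenched_law w (Pquenched w).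
Hypothesis PP_annealed : annealed_law P Pquenched PP.

Lemma annealed_avoid (n N : nat) : (0 < n)%N ->
  PP [set z | avoid n%:Z N z.2] =
  mean P (fun w => survival (omega w) n%:Z N 0).
Proof.
move=> n0; have -> : [set z : env R * walk_path | avoid n%:Z N z.2] =
    setT `*` avoid n%:Z N by apply/seteqP; split => z //= -[].
rewrite PP_annealed //; last exact: measurable_avoid.
by apply: eq_integral => w _; rewrite (quenched_avoid (Pquenched_law w)) // ltz_nat.
Qed.

End AnnealedLaw.

Theorem proposition3 (R : realType) (P : probability (env R) R)
  (J : R -> \bar R)
  (Pquenched : env R -> probability walk_path R)
  (PP : probability (env R * walk_path)%type R)
  (alpha : R)
  (P_stationary : stationary P) (P_ergodic : ergodic P)
  (A1 : condA1 P) (A2 : condA2 P J) (A3 : condA3 P) (A4 : condA4 P)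
  (Pquenched_law : forall w : env R, quenched_law w (Pquenched w))
  (PP_annealed : annealed_law P Pquenched PP)
  (alpha_gt0 : 0 < alpha) :
  let Y := fun (n : nat) (z : env R * walk_path) =>
    ((n%:R `^ (- alpha^-1))%:E * hitting_time R n z.2)%E in
  ((alpha%:E < kappa J)%E -> cvg_to0_in_probability PP Y) /\
  ((kappa J < alpha%:E)%E -> cvg_to_pinfty_in_probability PP Y).
Proof.
move=> Y; have [[J_ge0 _] ldp] := A2.
have scale_gt0 n : (0 < n)%N -> 0 < n%:R `^ alpha^-1 :> R.
  by move=> n0; rewrite powR_gt0 // ltr0n.
have Y_gt n t : (0 < n)%N -> 0 <= t -> [set z | t%:E < Y n z]%E =
    [set z | avoid n%:Z (Num.truncn (t * n%:R `^ alpha^-1)) z.2].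
  move=> n0 t0; rewrite /Y powRN; apply/seteqP; split => z /=.
    by move/(scaled_hitting_time_gt _ _ (scale_gt0 n n0) t0).
  by move/(scaled_hitting_time_gt _ _ (scale_gt0 n n0) t0).
have Y_ge0 n z : (0 <= Y n z)%E.
  by rewrite mule_ge0 ?lee_fin ?powR_ge0 ?hitting_time_ge0.
split.
- move=> al_k e e0.
  have [b /andP[al_b b_k]] := lte_real_between al_k; rewrite lte_fin in al_b.
  have b0 : 0 < b by exact: lt_trans al_b.
  have b1 : b <= 1.
    by rewrite -lee_fin ltW // (lt_le_trans b_k) // (kappa_le1 ldp J_ge0 A3 A4).
  have [C C0 hC] := moment_summable (moment_finite P_stationary A3 b)
    (moment_decay_below_kappa ldp J_ge0 A3 A4.2 b0 b_k).
  pose B n : R := e `^ (- b) * (C + C) * n%:R `^ (- (b / alpha - 1)).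
  have B0 : B n @[n --> \oo] --> 0.
    rewrite -[X in _ --> X](mulr0 (e `^ (- b) * (C + C))); apply: cvgMr.
    by apply: powRN_cvg0; rewrite subr_gt0 ltr_pdivlMr // mul1r.
  apply: (squeeze_cvge (f := fun=> 0%E) (h := EFin \o B)); last 2 first.
  + exact: cvg_cst.
  + by apply: cvg_EFin; [exact: nearW|exact: B0].
  near=> n; have n0 : (0 < n)%N by near: n; exact: nbhs_infty_gt.
  have nR : 0 < n%:R :> R by rewrite ltr0n.
  rewrite measure_ge0 /=.
  have -> : [set z | (e%:E < `|Y n z|)%E] = [set z | (e%:E < Y n z)%E].
    by apply/seteqP; split => z /=; rewrite gee0_abs.
  rewrite Y_gt ?(ltW e0) // (annealed_avoid Pquenched_law PP_annealed) //.
  have b01 : 0 < b <= 1 by rewrite b0.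
  apply: le_trans (mean_survival_le P_stationary b01 hC _ _) _.
  rewrite lee_fin /B.
  set t := e * _; have t0 : 0 < t by rewrite mulr_gt0 ?scale_gt0.
  have : (Num.truncn t).+1%:R `^ (- b) <= t `^ (- b).
    rewrite !powRN lef_pV2 ?posrE ?powR_gt0 //.
    apply: ge0_ler_powR; rewrite ?nnegrE ?(ltW b0) ?(ltW t0) //.
    by rewrite ltW // Num.Theory.truncnS_gt.
  move=> /(ler_wpM2r (mulr_ge0 (ltW nR) (addr_ge0 C0 C0))) /le_trans; apply.
  rewrite /t powRM ?(ltW e0) ?powR_ge0 // -powRrM.
  have -> : n%:R `^ (- (b / alpha - 1)) = n%:R `^ (alpha^-1 * - b) * n%:R :> R.
    rewrite -[X in _ = _ * X]powRr1 ?ltW // -powRD ?(gt_eqF nR) ?implybT //.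
    by congr (_ `^ _); ring.
  by rewrite le_eqVlt; apply/orP; left; apply/eqP; ring.
- move=> k_al M; case: (ltP M 0) => M0.
    rewrite (_ : (fun n => _) = fun=> 1%E); first exact: cvg_cst.
    apply/funext => n; rewrite (_ : [set z | _] = setT) ?probability_setT //.
    apply/seteqP; split => z //= _.
    by rewrite (lt_le_trans _ (Y_ge0 n z)) // lte_fin.
  have X0 := crossed_mean_cvg0 P_stationary ldp J_ge0 A1 alpha_gt0 k_al M0.
  apply: cvg_trans (_ : (1 - mean P (fun w => 1 - survival (omega w) n%:Z
      (Num.truncn (M * n%:R `^ alpha^-1)) 0)%R)%E @[n --> \oo] --> 1%E); last first.
    rewrite -[X in _ --> X](sube0 1%E); apply: cvgeB => //; exact: cvg_cst.
  apply: near_eq_cvg; near=> n.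
  have n0 : (0 < n)%N by near: n; exact: nbhs_infty_gt.
  rewrite Y_gt // (annealed_avoid Pquenched_law PP_annealed) //.
  set N := Num.truncn _.
  have ms := @measurable_survival R n%:Z N 0.
  have s01 w := survival_itv n%:Z (@omega_itv R w) N 0.
  have sum1 : (mean P (fun w => survival (omega w) n%:Z N 0) +
     mean P (fun w => 1 - survival (omega w) n%:Z N 0)%R = 1)%E.
    rewrite -meanD //.
    + by rewrite -(mean_cst P 1); apply: eq_integral => w _; rewrite addrC subrK.
    + by apply: measurable_funB.
    + by move=> w; have /andP[] := s01 w.
    + by move=> w; have /andP[] := s01 w; rewrite subr_ge0.
  rewrite -sum1 addeK // ge0_fin_numE.
    apply: (@le_lt_trans _ _ 1%E); last by rewrite ltry.
    by rewrite -sum1; apply: leeDr; apply: mean_ge0 => w; have /andP[] := s01 w.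
  by apply: mean_ge0 => w; have /andP[] := s01 w; rewrite subr_ge0.
Unshelve. all: by end_near. Qed.
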